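(* Let $m\ge3$ be an odd integer and $n=2m$, and let $\lambda>\frac{2n-2}{n-2}$. Let $\varphi:(0,1)\to(0,1)$ be continuous with $\lim_{r\to0^+}\varphi(r)=0$. Then there exists a $C^\infty$ positive solution $u$ of $$0\le-\Delta^m u\le u^\lambda\quad\text{in }\mathbb{R}^n\setminus\{0\}$$ such that $u(x)\neq O\left(\varphi(|x|)|x|^{-(n-2)}\log\frac{5}{|x|}\right)$ as $x\to0$.
   Context: $\Delta^m$ is the $m$-fold iterated Laplacian. For positive functions, ''$u(x)\neq O(h(x))$ as $x\to0$'' means $\limsup_{x\to0} u(x)/h(x)=\infty$. *)

(* Defs.v *)
(* classical reals. Points of R^n are represented as
   x : nat -> R, of which only the coordinates 0..n-1 are used. *)
From Stdlib Require Import Reals Lra List.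
Open Scope R_scope.

Fixpoint sumR (n : nat) (f : nat -> R) : R :=
  match n with
  | O => 0
  | S k => sumR k f + f k
  end.

Definition normn (n : nat) (x : nat -> R) : R :=
  sqrt (sumR n (fun i => x i * x i)).

Definition upd (x : nat -> R) (i : nat) (t : R) : nat -> R :=
  fun j => if Nat.eqb j i then t else x j.

Definition punct (n : nat) (x : nat -> R) : Prop := normn n x > 0.

Definition is_partial (U : (nat -> R) -> Prop) (i : nat)
  (f g : (nat -> R) -> R) : Prop :=
  forall x, U x -> derivable_pt_lim (fun t => f (upd x i t)) (x i) (g x).

Definition cont_on (n : nat) (U : (nat -> R) -> Prop) (g : (nat -> R) -> R) : Prop :=
  forall x, U x -> forall eps, eps > 0 -> exists d, d > 0 /\
    forall y, U y -> normn n (fun i => y i - x i) < d -> Rabs (g y - g x) < eps.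

Inductive iter_partial (U : (nat -> R) -> Prop) :
  list nat -> ((nat -> R) -> R) -> ((nat -> R) -> R) -> Prop :=
| ip_nil : forall f, iter_partial U nil f f
| ip_cons : forall i l f h g,
    is_partial U i f h -> iter_partial U l h g -> iter_partial U (i :: l) f g.

Definition smooth_on (n : nat) (U : (nat -> R) -> Prop) (f : (nat -> R) -> R) : Prop :=
  cont_on n U f /\
  forall l : list nat, Forall (fun i => (i < n)%nat) l ->
    exists g, iter_partial U l f g /\ cont_on n U g.

Definition is_laplacian (n : nat) (U : (nat -> R) -> Prop) (f g : (nat -> R) -> R) : Prop :=
  exists d2 : nat -> (nat -> R) -> R,
    (forall i, (i < n)%nat -> iter_partial U (i :: i :: nil) f (d2 i)) /\
    forall x, U x -> g x = sumR n (fun i => d2 i x).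

Inductive iter_laplacian (n : nat) (U : (nat -> R) -> Prop) :
  nat -> ((nat -> R) -> R) -> ((nat -> R) -> R) -> Prop :=
| il_zero : forall f, iter_laplacian n U 0 f f
| il_succ : forall k f h g,
    is_laplacian n U f h -> iter_laplacian n U k h g ->
    iter_laplacian n U (S k) f g.

(* Main.v *)
Require Import Defs.
From Corelib Require Import ssreflect.
From Stdlib Require Import Reals Lra List.
From Stdlib Require Import Factorial Lia FunctionalExtensionality IndefiniteDescription.
From Coquelicot Require Import Coquelicot.
Open Scope R_scope.
Unset SsrRewrite.

(* With n = 2m and t = 1 - y, the Laplacian of J(1 - s|x - c|^2) is 4s (t J'' - m J') at
   y = 1 - s|x - c|^2, and (t D^2 - m D)^m = D^(2m-1) t^m D.  Let g be a (2m-1)-fold primitive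
   of exp(-1/y) 1_{y > 0}.  The choice J' = g t^(-m) gives a compactly supported function H with
   source of one sign, bounded by a multiple of |x|^(-(n-2)); the choice J' = g/(t + d) gives
   a compactly supported smoothed logarithm V_d with V_d(centre) ~ log(1/d) whose source is
   at least -K and at most K d^(-m) (here m odd is used).  Take points x_j -> 0 with
   |x_j|^2 = a_j and phi(|x_j|) <= 4^(-j), and
     u = C |x|^(-(n-2)) + sum_j eps_j a_j^(-(m-1)) (V_d((x - x_j) scaled) - K' H(x scaled)),
   a locally finite sum, with eps_j ~ 2^(-j) and d_j a small power of a_j.  The H terms
   absorb the negative part of the sources, the inequality lambda > (2n-2)/(n-2) leaves room
   for the power of a_j in d_j, and at x_j the logarithm beats phi because
   eps_j >> phi(|x_j|). *)

(** * The radial operator on sequences of derivatives *)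

(** In dimension n = 2m the logarithm is, up to a constant, the fundamental solution of Delta^m. No
    potential with a prescribed source is solved for: every function is given in closed form and its
    source is computed. The variable y = 1 - s|x - c|^2 keeps the profiles smooth at the centre and
    turns m Laplacians into D^(2m-1) t^m J', where a factor t^(-m) or 1/(t + d) of J' can be divided
    out. Division of t^m by t + d leaves the remainder (-d)^m/(t + d); after 2m-1 derivatives it can
    be of order d^(-m), and m odd gives it the harmless sign. The threshold for lambda: near x_j, u
    is at least a multiple of a_j^(-(m-1)), so u^lambda is at least a multiple of
    a_j^(-(m-1)lambda), while the bubble has source of order a_j^(-(m-1)) a_j^(-m) d_j^(-m). A
    positive power of a_j is left for d_j exactly when (m-1)lambda > 2m-1, that is, lambda >
    (2n-2)/(n-2). It has to be a power, so that log(1/d_j) is comparable to log(1/|x_j|). *)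

Definition shiftS (a : nat -> R) : nat -> R := fun k => a (S k).
(* On the derivatives at y, multiplication by t = 1 - y; at k = 0 the junk a (pred 0) is
   killed by INR 0. *)
Definition mulS (t : R) (a : nat -> R) : nat -> R :=
  fun k => t * a k - INR k * a (pred k).
Definition lapS (t c : R) (a : nat -> R) : nat -> R :=
  fun k => mulS t (shiftS (shiftS a)) k - c * a (S k).

Lemma shiftS_mulS t a :
  shiftS (mulS t a) = fun k => mulS t (shiftS a) k - a k.
Proof.
  apply functional_extensionality; intros [|k]; unfold shiftS, mulS;
    rewrite ?S_INR; simpl; ring.
Qed.

(** Since t' = -1, moving D past t costs one second derivative, which raises c by one. *)
Lemma shiftS_lapS t c a : shiftS (lapS t c a) = lapS t (c + 1) (shiftS a).
Proof.
  apply functional_extensionality; intros [|k]; unfold shiftS, lapS, mulS, shiftS;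
    rewrite ?S_INR; simpl; ring.
Qed.

Lemma iter_mulS_linear t k a b c :
  Nat.iter k (mulS t) (fun i => a i - c * b i) =
  fun i => Nat.iter k (mulS t) a i - c * Nat.iter k (mulS t) b i.
Proof.
  induction k as [|k IH]; [reflexivity|].
  rewrite !Nat.iter_succ, IH.
  apply functional_extensionality; intros i; unfold mulS; simpl; ring.
Qed.

(** Product rule with t' = -1: D t^(k+1) = t^k (t D - (k + 1)). *)
Lemma shiftS_iter_mulS t k a :
  shiftS (Nat.iter (S k) (mulS t) a) =
  Nat.iter k (mulS t) (fun i => mulS t (shiftS a) i - INR (S k) * a i).
Proof.
  induction k as [|k IH].
  - simpl Nat.iter. rewrite shiftS_mulS. apply functional_extensionality; intros i.
    simpl; ring.
  - rewrite Nat.iter_succ, shiftS_mulS, IH, !iter_mulS_linear.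
    apply functional_extensionality; intros i.
    assert (E2 : mulS t (fun i0 => Nat.iter k (mulS t) (mulS t (shiftS a)) i0
               - INR (S k) * Nat.iter k (mulS t) a i0) i =
             mulS t (Nat.iter k (mulS t) (mulS t (shiftS a))) i
             - INR (S k) * mulS t (Nat.iter k (mulS t) a) i)
      by (unfold mulS; ring).
    rewrite E2, (S_INR (S k)), !Nat.iter_succ. ring.
Qed.

Lemma iter_lapS_shiftS t k c a :
  shiftS (Nat.iter k (lapS t c) a) = Nat.iter k (lapS t (c + 1)) (shiftS a).
Proof.
  induction k as [|k IH]; [reflexivity|].
  now rewrite !Nat.iter_succ, shiftS_lapS, IH.
Qed.

(* t f'' - (k + 1) f' = (t f' - k f)', as t = 1 - y. *)
Lemma lapS_as_shiftS t k a :
  (fun i => mulS t (shiftS (shiftS a)) i - INR (S k) * shiftS a i) =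
  shiftS (fun i => mulS t (shiftS a) i - INR k * a i).
Proof.
  apply functional_extensionality; intros i.
  destruct i; unfold shiftS, mulS; rewrite ?S_INR; simpl; ring.
Qed.

(** In the step to k + 1, one derivative falls on t^(k+1) and leaves t^k D(t a' - k a). The
    induction hypothesis, applied to t a' - k a, uses 2k more, and the last one raises the parameter
    k + 1 to k + 2. *)
Lemma iter_lapS_shift t k : forall a,
  Nat.iter (2 * k) shiftS (Nat.iter k (mulS t) (shiftS a)) =
  Nat.iter k (lapS t (INR (S k))) (shiftS a).
Proof.
  induction k as [|k IH]; intros a; [reflexivity|].
  replace (2 * S k)%nat with (S (S (2 * k))) by lia.
  rewrite Nat.iter_succ, Nat.iter_succ_r, shiftS_iter_mulS, lapS_as_shiftS, IH.
  rewrite <- lapS_as_shiftS.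
  change (fun i => mulS t (shiftS (shiftS a)) i - INR (S k) * shiftS a i)
    with (lapS t (INR (S k)) a).
  rewrite <- Nat.iter_succ_r, iter_lapS_shiftS, <- S_INR. reflexivity.
Qed.

(* The operator identity (t D^2 - m D)^m = D^(2m-1) t^m D with t = 1 - y, m = k + 1. *)
Lemma iter_lapS_closed t k a :
  Nat.iter (S k) (lapS t (INR (S k))) a 0%nat =
  Nat.iter (S k) (mulS t) (shiftS a) (S (2 * k)).
Proof.
  rewrite Nat.iter_succ_r.
  change (lapS t (INR (S k)) a) with
    (fun i => mulS t (shiftS (shiftS a)) i - INR (S k) * shiftS a i).
  rewrite lapS_as_shiftS, <- iter_lapS_shift, <- lapS_as_shiftS, <- shiftS_iter_mulS.
  assert (E : forall j b, Nat.iter j shiftS b 0%nat = b j).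
  { induction j as [|j IHj]; intros b; [reflexivity|].
    rewrite Nat.iter_succ_r, IHj. reflexivity. }
  now rewrite E.
Qed.

(** * Jets of smooth functions of one variable *)

Definition jet := nat -> R -> R.

(** The derivatives are carried as data, so that the algebra of sequences applies at each point y.
    The half-line y < b stops before the singularity of t^(-m) at 1, or of 1/(t + d) at 1 + d. *)
Definition is_jet (b : R) (J : jet) : Prop :=
  forall k y, y < b -> is_derive (J k) y (J (S k) y).

Definition jshift (J : jet) : jet := fun k => J (S k).
Definition jmulT (J : jet) : jet := fun k y => mulS (1 - y) (fun i => J i y) k.
Definition jlap (c : R) (J : jet) : jet := fun k y => lapS (1 - y) c (fun i => J i y) k.

(** Leibniz rule as a recursion without binomial coefficients: order k is a sum of 2^k products,
    whence the factor in [jmul_le]. *)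
Fixpoint jmul (J K : jet) (k : nat) (y : R) : R :=
  match k with
  | O => J 0%nat y * K 0%nat y
  | S k => jmul (jshift J) K k y + jmul J (jshift K) k y
  end.

Definition janti (J : jet) : jet :=
  fun k => match k with O => fun y => RInt (J 0%nat) 0 y | S k => J k end.

Definition jinv (c : R) : jet := fun k y => INR (fact k) / (c - y) ^ S k.

Lemma is_jet_shift b J : is_jet b J -> is_jet b (jshift J).
Proof. intros HJ k y Hy; apply (HJ (S k) y Hy). Qed.

Lemma is_jet_mulT b J : is_jet b J -> is_jet b (jmulT J).
Proof.
  intros HJ k y Hy; unfold jmulT, mulS.
  evar_last.
  - apply: is_derive_minus.
    + apply: is_derive_mult; [|apply HJ, Hy|intros; apply Rmult_comm].
      apply: is_derive_minus; [apply: is_derive_const|apply: is_derive_id].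
    + apply: is_derive_scal. apply HJ, Hy.
  - destruct k; unfold minus, plus, opp, mult, scal, zero, one; simpl;
      unfold mult; simpl; [ring|].
    destruct k; simpl; ring.
Qed.

Lemma is_jet_lap b c J : is_jet b J -> is_jet b (jlap c J).
Proof.
  intros HJ k y Hy; unfold jlap, lapS.
  apply: is_derive_minus.
  - apply (is_jet_mulT b (jshift (jshift J))); [|exact Hy].
    now do 2 apply is_jet_shift.
  - apply: is_derive_scal. apply HJ, Hy.
Qed.

Lemma is_jet_iter b (F : jet -> jet) :
  (forall J, is_jet b J -> is_jet b (F J)) ->
  forall k J, is_jet b J -> is_jet b (Nat.iter k F J).
Proof. intros HF k J HJ; induction k; [exact HJ|rewrite Nat.iter_succ; auto]. Qed.

Lemma is_jet_mul b J K : is_jet b J -> is_jet b K -> is_jet b (jmul J K).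
Proof.
  intros HJ HK k; revert J K HJ HK; induction k as [|k IH]; intros J K HJ HK y Hy.
  - simpl. evar_last.
    + apply: is_derive_mult; [apply HJ, Hy|apply HK, Hy|intros; apply Rmult_comm].
    + unfold plus, mult; simpl; unfold jshift; ring.
  - change (jmul J K (S k)) with
      (fun y => jmul (jshift J) K k y + jmul J (jshift K) k y).
    change (jmul J K (S (S k)) y) with
      (jmul (jshift J) K (S k) y + jmul J (jshift K) (S k) y).
    apply: is_derive_plus; apply IH; auto using is_jet_shift.
Qed.

Lemma is_jet_continuous b J k y : is_jet b J -> y < b -> continuous (J k) y.
Proof. intros HJ Hy; apply: ex_derive_continuous. eexists; apply HJ, Hy. Qed.

Lemma is_jet_anti b J : 0 < b -> is_jet b J -> is_jet b (janti J).
Proof.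
  intros Hb HJ [|k] y Hy; [|apply HJ, Hy].
  simpl. apply (is_derive_RInt (J 0%nat) (fun x => RInt (J 0%nat) 0 x) 0 y).
  - assert (Hd : 0 < b - y) by lra.
    exists (mkposreal _ Hd); intros z Hz.
    apply: RInt_correct. apply: ex_RInt_continuous; intros x Hx.
    apply (is_jet_continuous b); [exact HJ|].
    apply Rabs_def2 in Hz; unfold minus, plus, opp in Hz; simpl in Hz.
    apply Rle_lt_trans with (1 := proj2 Hx). unfold Rmax; destruct Rle_dec; lra.
  - apply (is_jet_continuous b); auto.
Qed.

Lemma is_jet_inv c : is_jet c (jinv c).
Proof.
  intros k y Hy; unfold jinv.
  assert (Hc : (c - y) ^ S k <> 0) by (apply pow_nonzero; lra).
  evar_last.
  - apply: is_derive_scal. apply: is_derive_inv; [|exact Hc].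
    apply: is_derive_pow. apply: is_derive_minus; [apply: is_derive_const|apply: is_derive_id].
  - unfold minus, plus, opp, mult, scal, zero, one; simpl pred.
    change (fact (S k)) with ((S k) * fact k)%nat. rewrite mult_INR.
    simpl pow. simpl in Hc.
    unfold mult; simpl (zero : R).
    set (n := INR (S k)). simpl.
    assert (c - y <> 0) by lra. assert ((c-y)^k <> 0) by (apply pow_nonzero; lra).
    field; auto.
Qed.

(** The transfer from a formula for a function to its derivatives: a product such as t^m J' is
    simplified at order 0 only, and its (2m-1)-st derivative is then read off. *)
Lemma is_jet_unique b J K : is_jet b J -> is_jet b K ->
  (forall y, y < b -> J 0%nat y = K 0%nat y) ->
  forall k y, y < b -> J k y = K k y.
Proof.
  intros HJ HK H0 k; induction k as [|k IH]; intros y Hy; [auto|].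
  transitivity (Derive (J k) y); [symmetry; apply is_derive_unique, HJ, Hy|].
  apply is_derive_unique. apply is_derive_ext_loc with (K k); [|apply HK, Hy].
  assert (Hd : 0 < b - y) by lra.
  exists (mkposreal _ Hd); intros z Hz. symmetry; apply IH.
  apply Rabs_def2 in Hz; unfold minus, plus, opp in Hz; simpl in Hz; lra.
Qed.

Lemma iter_jmulT j J k y :
  Nat.iter j jmulT J k y = Nat.iter j (mulS (1 - y)) (fun i => J i y) k.
Proof.
  revert k; induction j as [|j IH]; intros k; [reflexivity|].
  rewrite !Nat.iter_succ. unfold jmulT at 1, mulS at 1 3.
  now rewrite !IH.
Qed.

Lemma iter_jlap j c J k y :
  Nat.iter j (jlap c) J k y = Nat.iter j (lapS (1 - y) c) (fun i => J i y) k.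
Proof.
  revert k; induction j as [|j IH]; intros k; [reflexivity|].
  rewrite !Nat.iter_succ. unfold jlap at 1, lapS at 1 3, mulS, shiftS.
  now rewrite !IH.
Qed.

Lemma iter_jlap_closed p J y :
  Nat.iter (S p) (jlap (INR (S p))) J 0%nat y =
  Nat.iter (S p) jmulT (jshift J) (S (2 * p)) y.
Proof. rewrite iter_jlap, iter_jmulT. apply (iter_lapS_closed (1 - y) p). Qed.

Lemma iter_jmulT_0 j J y : Nat.iter j jmulT J 0%nat y = (1 - y) ^ j * J 0%nat y.
Proof.
  induction j as [|j IH]; [simpl; ring|].
  rewrite Nat.iter_succ; unfold jmulT at 1, mulS; simpl. rewrite IH. ring.
Qed.

Lemma jmul_nonneg J K y k :
  (forall i, (i <= k)%nat -> 0 <= J i y) -> (forall i, (i <= k)%nat -> 0 <= K i y) ->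
  0 <= jmul J K k y.
Proof.
  revert J K; induction k as [|k IH]; intros J K HJ HK; simpl.
  - apply Rmult_le_pos; auto.
  - apply Rplus_le_le_0_compat; apply IH; intros i Hi; unfold jshift;
      first [apply HJ|apply HK]; lia.
Qed.

Lemma jmul_le J K y k A B :
  (forall i, (i <= k)%nat -> 0 <= J i y <= A) -> (forall i, (i <= k)%nat -> 0 <= K i y <= B) ->
  jmul J K k y <= 2 ^ k * (A * B).
Proof.
  revert J K; induction k as [|k IH]; intros J K HJ HK; simpl.
  - rewrite Rmult_1_l. apply Rmult_le_compat; first [apply HJ|apply HK]; lia.
  - assert (H1 : jmul (jshift J) K k y <= 2 ^ k * (A * B))
      by (apply IH; intros i Hi; unfold jshift; first [apply HJ|apply HK]; lia).
    assert (H2 : jmul J (jshift K) k y <= 2 ^ k * (A * B))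
      by (apply IH; intros i Hi; unfold jshift; first [apply HJ|apply HK]; lia).
    lra.
Qed.

(** Composed with 1 - s|x - c|^2, such a profile vanishes where s|x - c|^2 >= 1 and is smooth across
    that sphere. *)
Definition jflat (J : jet) : Prop := forall k y, y <= 0 -> J k y = 0.

Lemma jflat_mul J K : jflat J -> jflat (jmul J K).
Proof.
  intros HJ k; revert J K HJ; induction k as [|k IH]; intros J K HJ y Hy; simpl.
  - rewrite HJ; auto; ring.
  - rewrite !IH; auto; [ring|]. intros i z Hz; apply HJ, Hz.
Qed.

Lemma jflat_anti J : jflat J -> jflat (janti J).
Proof.
  intros HJ [|k] y Hy; [|apply HJ, Hy]. simpl.
  rewrite (RInt_ext _ (fun _ => 0)).
  - rewrite RInt_const. unfold scal; simpl; unfold mult; simpl; ring.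
  - intros x Hx. apply HJ. apply Rlt_le, Rlt_le_trans with (1 := proj2 Hx).
    unfold Rmax; destruct Rle_dec; lra.
Qed.

Lemma jflat_iter (F : jet -> jet) :
  (forall J, jflat J -> jflat (F J)) -> forall k J, jflat J -> jflat (Nat.iter k F J).
Proof. intros HF k J HJ; induction k; [exact HJ|rewrite Nat.iter_succ; auto]. Qed.

Lemma jflat_lap c J : jflat J -> jflat (jlap c J).
Proof.
  intros HJ k y Hy; unfold jlap, lapS, mulS, shiftS; rewrite !HJ by auto; ring.
Qed.

Lemma is_derive_continuity_pt f x l : is_derive f x l -> continuity_pt f x.
Proof.
  intros H. apply derivable_continuous_pt. exists l. now apply is_derive_Reals.
Qed.

Lemma increment_le (F H f h : R -> R) a b : a <= b ->
  (forall x, a <= x <= b -> is_derive F x (f x)) ->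
  (forall x, a <= x <= b -> is_derive H x (h x)) ->
  (forall x, a <= x <= b -> h x <= f x) -> H b - H a <= F b - F a.
Proof.
  intros Hab HF HH Hle.
  destruct (MVT_gen (fun x => F x - H x) a b (fun x => f x - h x)) as [c [Hc E]].
  - intros x Hx; rewrite Rmin_left, Rmax_right in Hx by lra.
    apply: is_derive_minus; [apply HF|apply HH]; lra.
  - intros x Hx; rewrite Rmin_left, Rmax_right in Hx by lra.
    apply is_derive_continuity_pt with (f x - h x).
    apply: is_derive_minus; [apply HF|apply HH]; lra.
  - rewrite Rmin_left, Rmax_right in Hc by lra.
    specialize (Hle c Hc). assert (0 <= (f c - h c) * (b - a)) by (apply Rmult_le_pos; lra).
    lra.
Qed.

(** * The flat function exp(-1/y) and its iterated primitives *)

Definition flat_exp (k : nat) (y : R) : R :=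
  match Rle_dec y 0 with left _ => 0 | right _ => (/ y) ^ k * exp (- / y) end.

(** The j-th derivative of y^(-k) exp(-1/y), extended by 0. The innermost derivative is expanded
    first, so the family over all k is closed under differentiation. *)
Fixpoint flat_jet (j k : nat) (y : R) : R :=
  match j with
  | O => flat_exp k y
  | S j => flat_jet j (S (S k)) y - INR k * flat_jet j (S k) y
  end.

(** The inequality 1 + z/N <= exp(z/N), raised to the power N. *)
Lemma pow_le_exp N z : 0 <= z -> z ^ N <= INR N ^ N * exp z.
Proof.
  intros Hz. destruct N as [|N]; [simpl; generalize (exp_ineq1_le z); lra|].
  assert (HN : 0 < INR (S N)) by (apply lt_0_INR; lia).
  replace (exp z) with (exp (z / INR (S N)) ^ S N).
  - rewrite <- Rpow_mult_distr. apply pow_incr; split; [exact Hz|].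
    generalize (exp_ineq1_le (z / INR (S N))); intros H.
    apply Rle_trans with (INR (S N) * (z / INR (S N))); [right; field; lra|].
    apply Rmult_le_compat_l; lra.
  - assert (E : forall n a, exp a ^ n = exp (INR n * a)).
    { intros n a; induction n as [|n IH]; [now rewrite Rmult_0_l, exp_0|].
      rewrite <- tech_pow_Rmult, IH, S_INR, <- exp_plus. f_equal; ring. }
    rewrite E. f_equal. field. lra.
Qed.

(** A quadratic bound is what makes the derivative at 0 exist and vanish. It is the bound of a power
    by the exponential, with exponent k + 2 at 1/h. *)
Lemma flat_exp_le k h : 0 <= flat_exp k h <= INR (S (S k)) ^ S (S k) * (h * h).
Proof.
  unfold flat_exp; destruct Rle_dec as [H|H].
  - split; [lra|]. apply Rmult_le_pos; [apply pow_le, pos_INR|nra].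
  - assert (Hh : 0 < / h) by (apply Rinv_0_lt_compat; lra).
    split; [apply Rmult_le_pos; [apply pow_le; lra|apply Rlt_le, exp_pos]|].
    generalize (pow_le_exp (S (S k)) (/ h) (Rlt_le _ _ Hh)); intros P.
    rewrite exp_Ropp. generalize (exp_pos (/ h)); intros Pe.
    apply Rmult_le_reg_r with (exp (/ h) * (/ h * / h)); [apply Rmult_lt_0_compat; nra|].
    replace ((/ h) ^ k * / exp (/ h) * (exp (/ h) * (/ h * / h))) with ((/ h) ^ S (S k))
      by (simpl; field; lra).
    replace (INR (S (S k)) ^ S (S k) * (h * h) * (exp (/ h) * (/ h * / h)))
      with (INR (S (S k)) ^ S (S k) * exp (/ h)) by (field; lra).
    exact P.
Qed.

Lemma is_derive_flat_exp k y :
  is_derive (flat_exp k) y (flat_exp (S (S k)) y - INR k * flat_exp (S k) y).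
Proof.
  destruct (Rtotal_order y 0) as [Hy|[->|Hy]].
  - replace (flat_exp _ _ - _) with 0 by (unfold flat_exp; destruct Rle_dec; [ring|lra]).
    apply is_derive_ext_loc with (fun _ => 0); [|apply: is_derive_const].
    assert (Hd : 0 < - y) by lra.
    exists (mkposreal _ Hd); intros z Hz.
    apply Rabs_def2 in Hz; unfold minus, plus, opp in Hz; simpl in Hz.
    unfold flat_exp; destruct Rle_dec; [reflexivity|lra].
  - replace (flat_exp _ _ - _) with 0 by (unfold flat_exp; destruct Rle_dec; [ring|lra]).
    apply is_derive_Reals. intros eps Heps.
    set (A := INR (S (S k)) ^ S (S k)).
    assert (HA : 0 <= A) by (apply pow_le, pos_INR).
    assert (Hd : 0 < eps / (A + 1)) by (apply Rdiv_lt_0_compat; lra).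
    exists (mkposreal _ Hd); intros h Hh Hhd; simpl in Hhd.
    replace (flat_exp k 0) with 0 by (unfold flat_exp; destruct Rle_dec; lra).
    rewrite Rplus_0_l, !Rminus_0_r. destruct (flat_exp_le k h) as [F1 F2]. fold A in F2.
    unfold Rdiv. rewrite Rabs_mult, Rabs_inv, (Rabs_pos_eq (flat_exp k h)) by exact F1.
    assert (Hp : 0 < Rabs h) by (apply Rabs_pos_lt, Hh).
    replace (h * h) with (Rabs h * Rabs h) in F2
      by (rewrite <- Rabs_mult; apply Rabs_pos_eq; nra).
    apply Rle_lt_trans with (A * Rabs h).
    + apply Rmult_le_reg_r with (Rabs h); [exact Hp|].
      rewrite Rmult_assoc, Rinv_l by lra. lra.
    + apply Rle_lt_trans with ((A + 1) * Rabs h); [nra|].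
      apply Rmult_lt_compat_l with (r := A + 1) in Hhd; [|lra].
      replace ((A + 1) * (eps / (A + 1))) with eps in Hhd by (field; lra). exact Hhd.
  - apply is_derive_ext_loc with (fun z => (/ z) ^ k * exp (- / z)).
    + exists (mkposreal _ Hy); intros z Hz.
      apply Rabs_def2 in Hz; unfold minus, plus, opp in Hz; simpl in Hz.
      unfold flat_exp; destruct Rle_dec; [lra|reflexivity].
    + replace (flat_exp (S (S k)) y - INR k * flat_exp (S k) y) with
        ((/ y) ^ S (S k) * exp (- / y) - INR k * ((/ y) ^ S k * exp (- / y)))
        by (unfold flat_exp; destruct Rle_dec; [lra|reflexivity]).
      auto_derive; [split; lra|].
      destruct k as [|k]; simpl; field; lra.
Qed.

Lemma is_jet_flat b k : is_jet b (fun j => flat_jet j k).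
Proof.
  intros j; revert k; induction j as [|j IH]; intros k y Hy.
  - apply is_derive_flat_exp.
  - change (is_derive (fun y => flat_jet j (S (S k)) y - INR k * flat_jet j (S k) y) y
      (flat_jet (S j) (S (S k)) y - INR k * flat_jet (S j) (S k) y)).
    apply: is_derive_minus; [apply IH, Hy|apply: is_derive_scal; apply IH, Hy].
Qed.

Lemma jflat_flat k : jflat (fun j => flat_jet j k).
Proof.
  intros j; revert k; induction j as [|j IH]; intros k y Hy; simpl.
  - unfold flat_exp; destruct Rle_dec; [reflexivity|lra].
  - rewrite !IH by auto; ring.
Qed.

(* Integrating a nonnegative flat function [N] times makes all its derivatives up to
   order [N] nonnegative, so no estimate of derivatives of exp(-1/y) is ever needed. *)
Definition flat_prim (N : nat) : jet := Nat.iter N janti (fun j => flat_jet j 0).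

Lemma flat_prim_top N y : flat_prim N N y = flat_exp 0 y.
Proof.
  unfold flat_prim.
  assert (E : forall k J, Nat.iter N janti J (N + k)%nat = J k).
  { induction N as [|N IH]; intros k J; [reflexivity|]. simpl. apply IH. }
  specialize (E 0%nat (fun j => flat_jet j 0)).
  rewrite Nat.add_0_r in E. now rewrite E.
Qed.

Lemma is_jet_flat_prim N b : is_jet b (flat_prim N).
Proof.
  (* [janti] integrates from 0, so 0 has to lie in the half-line: the bound is enlarged and then
     restricted. *)
  assert (H : is_jet (Rmax b 1) (flat_prim N)).
  { apply is_jet_iter; [|apply is_jet_flat]. intros J; apply is_jet_anti.
    apply Rlt_le_trans with (2 := Rmax_r b 1); lra. }
  intros k y Hy; apply H. apply Rlt_le_trans with (1 := Hy), Rmax_l.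
Qed.

Lemma jflat_flat_prim N : jflat (flat_prim N).
Proof. apply jflat_iter; [exact jflat_anti|apply jflat_flat]. Qed.

Lemma flat_exp0_bounds y : 0 <= flat_exp 0 y <= 1.
Proof.
  unfold flat_exp; destruct Rle_dec; [lra|]. simpl.
  generalize (exp_pos (- / y)); intros.
  assert (exp (- / y) <= exp 0).
  { apply Rlt_le, exp_increasing. assert (0 < / y) by (apply Rinv_0_lt_compat; lra). lra. }
  rewrite exp_0 in *. lra.
Qed.

Lemma flat_prim_bounds N k y : (k <= N)%nat -> 0 <= y <= 1 -> 0 <= flat_prim N k y <= 1.
Proof.
  revert k y; induction N as [|N IH]; intros k y Hk Hy.
  - replace k with 0%nat by lia. apply flat_exp0_bounds.
  - destruct k as [|k]; [|apply IH; auto; lia].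
    assert (E : flat_prim (S N) 0%nat 0 = 0) by (apply jflat_flat_prim; lra).
    assert (D : forall x, 0 <= x <= y ->
      is_derive (flat_prim (S N) 0%nat) x (flat_prim N 0%nat x)).
    { intros x _. apply (is_jet_flat_prim (S N) (x + 1) 0%nat x); lra. }
    assert (B : forall x, 0 <= x <= y -> 0 <= flat_prim N 0%nat x <= 1).
    { intros x Hx; apply IH; [lia|lra]. }
    split.
    + assert (H : 0 - 0 <= flat_prim (S N) 0%nat y - flat_prim (S N) 0%nat 0).
      { apply (increment_le _ (fun _ => 0) (flat_prim N 0%nat) (fun _ => 0));
          [lra|exact D|intros; apply: is_derive_const|apply B]. }
      lra.
    + assert (H : flat_prim (S N) 0%nat y - flat_prim (S N) 0%nat 0 <= y - 0).
      { apply (increment_le (fun x => x) (flat_prim (S N) 0%nat) (fun _ => 1)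
          (flat_prim N 0%nat));
          [lra|intros; apply: is_derive_id|exact D|apply B]. }
      lra.
Qed.

Lemma flat_prim_mono N x y : 0 <= x <= y -> y <= 1 ->
  flat_prim (S N) 0%nat x <= flat_prim (S N) 0%nat y.
Proof.
  intros Hxy Hy.
  assert (H : 0 - 0 <= flat_prim (S N) 0%nat y - flat_prim (S N) 0%nat x).
  { apply (increment_le _ (fun _ => 0) (flat_prim N 0%nat) (fun _ => 0)); [lra| | |].
    - intros z _. apply (is_jet_flat_prim (S N) (z + 1) 0%nat z); lra.
    - intros; apply: is_derive_const.
    - intros z Hz. apply (flat_prim_bounds N); [lia|lra]. }
  lra.
Qed.

Lemma flat_prim_pos N y : 0 < y <= 1 -> 0 < flat_prim N 0%nat y.
Proof.
  revert y; induction N as [|N IH]; intros y Hy.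
  - change (0 < flat_exp 0 y). unfold flat_exp; destruct Rle_dec; [lra|].
    simpl. generalize (exp_pos (- / y)); lra.
  - assert (H0 : 0 <= flat_prim (S N) 0%nat (y / 2)) by (apply flat_prim_bounds; [lia|lra]).
    destruct (MVT_gen (flat_prim (S N) 0%nat) (y / 2) y (flat_prim N 0%nat)) as [c [Hc E]].
    + intros x _. apply (is_jet_flat_prim (S N) (x + 1) 0%nat x); lra.
    + intros x _. apply is_derive_continuity_pt with (flat_prim N 0%nat x).
      apply (is_jet_flat_prim (S N) (x + 1) 0%nat x); lra.
    + rewrite Rmin_left, Rmax_right in Hc by lra.
      assert (0 < flat_prim N 0%nat c) by (apply IH; lra).
      assert (0 < flat_prim N 0%nat c * (y - y / 2)) by (apply Rmult_lt_0_compat; lra).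
      lra.
Qed.

(** * The two building blocks *)

Definition jconst (c : R) : jet := fun k _ => match k with O => c | S _ => 0 end.

Lemma is_jet_const b c : is_jet b (jconst c).
Proof. intros [|k] y Hy; apply: is_derive_const. Qed.

Definition jdiv (k : nat) (J : jet) : jet := Nat.iter k (fun J => jmul J (jinv 1)) J.

Lemma is_jet_div k J : is_jet 1 J -> is_jet 1 (jdiv k J).
Proof.
  apply is_jet_iter. intros K HK. apply is_jet_mul; [exact HK|apply is_jet_inv].
Qed.

Lemma jdiv_0 k J y : jdiv k J 0%nat y = (/ (1 - y)) ^ k * J 0%nat y.
Proof.
  unfold jdiv; induction k as [|k IH]; [simpl; ring|].
  rewrite Nat.iter_succ. simpl. rewrite IH. unfold jinv, Rdiv. simpl. rewrite Rmult_1_r. ring.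
Qed.

Lemma inv_pow_cancel k y : y < 1 -> (1 - y) ^ k * (/ (1 - y)) ^ k = 1.
Proof.
  intros Hy. rewrite <- Rpow_mult_distr, Rinv_r by lra. apply pow1.
Qed.

Lemma is_derive_inv_pow k y : y < 1 ->
  is_derive (fun y => (/ (1 - y)) ^ k) y (INR k * (/ (1 - y)) ^ S k).
Proof.
  intros Hy. auto_derive; [lra|]. change (1 + - y) with (1 - y).
  destruct k as [|k]; [simpl; field; lra|].
  change (pred (S k)) with k. rewrite <- !tech_pow_Rmult. field; lra.
Qed.

(** At y = 1 - |x|^2 this is |x|^(-2p) = |x|^(-(n-2)), where n = 2(p + 1). *)
Definition jet_base (p : nat) : jet := jdiv p (jconst 1).

Lemma is_jet_base p : is_jet 1 (jet_base p).
Proof. apply is_jet_div, is_jet_const. Qed.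

Lemma jet_base_0 p y : jet_base p 0%nat y = (/ (1 - y)) ^ p.
Proof. unfold jet_base. rewrite jdiv_0. simpl. ring. Qed.

(** Here t^(p+1) J' is the constant p, which the 2p + 1 derivatives of the closed form kill. *)
Lemma jet_base_lap p y : y < 1 ->
  Nat.iter (S p) (jlap (INR (S p))) (jet_base p) 0%nat y = 0.
Proof.
  intros Hy. rewrite iter_jlap_closed.
  change 0 with (jconst (INR p) (S (2 * p)) y).
  apply (is_jet_unique 1); [|apply is_jet_const| |exact Hy].
  - apply is_jet_iter; [apply is_jet_mulT|]. apply is_jet_shift, is_jet_base.
  - intros z Hz. rewrite iter_jmulT_0. unfold jshift; simpl jconst.
    assert (E : jet_base p 1%nat z = INR p * (/ (1 - z)) ^ S p).
    { transitivity (Derive (jet_base p 0%nat) z).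
      - symmetry. apply is_derive_unique. apply (is_jet_base p 0%nat z Hz).
      - apply is_derive_unique. apply is_derive_ext with (fun y => (/ (1 - y)) ^ p).
        + intros t; symmetry; apply jet_base_0.
        + apply is_derive_inv_pow, Hz. }
    rewrite E. transitivity (INR p * ((1 - z) ^ S p * (/ (1 - z)) ^ S p)); [ring|].
    rewrite inv_pow_cancel by exact Hz. ring.
Qed.

Definition jet_shell (p : nat) : jet := janti (jdiv (S p) (flat_prim (S (2 * p)))).

Lemma is_jet_shell p : is_jet 1 (jet_shell p).
Proof. apply is_jet_anti; [lra|]. apply is_jet_div, is_jet_flat_prim. Qed.

Lemma jflat_shell p : jflat (jet_shell p).
Proof.
  apply jflat_anti, jflat_iter; [|apply jflat_flat_prim].
  intros J HJ; apply jflat_mul, HJ.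
Qed.

(** The factor t^(p+1) cancels the division in J', and 2p + 1 derivatives undo the primitives in
    g. *)
Lemma jet_shell_lap p y : y < 1 ->
  Nat.iter (S p) (jlap (INR (S p))) (jet_shell p) 0%nat y = flat_exp 0 y.
Proof.
  intros Hy. rewrite iter_jlap_closed, <- (flat_prim_top (S (2 * p))).
  apply (is_jet_unique 1); [|apply is_jet_flat_prim| |exact Hy].
  - apply is_jet_iter; [apply is_jet_mulT|]. apply is_jet_shift, is_jet_shell.
  - intros z Hz. rewrite iter_jmulT_0.
    change (jshift (jet_shell p) 0%nat z) with
      (jdiv (S p) (flat_prim (S (2 * p))) 0%nat z).
    rewrite jdiv_0, <- Rmult_assoc, inv_pow_cancel by exact Hz. ring.
Qed.

(** The derivative p t^(-(p+1)) of t^(-p) dominates J' = g t^(-(p+1)), because g <= 1 <= p. *)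
Lemma jet_shell_bounds p y : (1 <= p)%nat -> y < 1 ->
  0 <= jet_shell p 0%nat y <= (/ (1 - y)) ^ p.
Proof.
  intros Hp Hy.
  assert (Hi : 0 < / (1 - y)) by (apply Rinv_0_lt_compat; lra).
  destruct (Rle_dec y 0) as [H|H].
  { rewrite jflat_shell by exact H. split; [lra|]. apply pow_le; lra. }
  assert (E0 : jet_shell p 0%nat 0 = 0) by (apply jflat_shell; lra).
  assert (D : forall x, 0 <= x <= y -> is_derive (jet_shell p 0%nat) x
     ((/ (1 - x)) ^ S p * flat_prim (S (2 * p)) 0%nat x)).
  { intros x Hx. rewrite <- jdiv_0. apply (is_jet_shell p 0%nat x). lra. }
  assert (B : forall x, 0 <= x <= y -> 0 <= flat_prim (S (2 * p)) 0%nat x <= 1).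
  { intros x Hx. apply flat_prim_bounds; [lia|lra]. }
  assert (P : forall x, 0 <= x <= y -> 0 < (/ (1 - x)) ^ S p).
  { intros x Hx. apply pow_lt, Rinv_0_lt_compat; lra. }
  split.
  - assert (0 - 0 <= jet_shell p 0%nat y - jet_shell p 0%nat 0); [|lra].
    eapply (increment_le _ (fun _ => 0) _ (fun _ => 0));
      [lra|exact D|intros; apply: is_derive_const|].
    intros x Hx; cbv beta. specialize (B x Hx); specialize (P x Hx).
    apply Rmult_le_pos; lra.
  - assert (jet_shell p 0%nat y - jet_shell p 0%nat 0 <= (/ (1 - y)) ^ p - (/ (1 - 0)) ^ p).
    { apply (increment_le (fun y => (/ (1 - y)) ^ p) _ (fun x => INR p * (/ (1 - x)) ^ S p) _ 0 y
        ltac:(lra) ltac:(intros; apply is_derive_inv_pow; lra) D).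
      intros x Hx; specialize (B x Hx); specialize (P x Hx).
      apply le_INR in Hp; simpl INR in Hp.
      rewrite Rmult_comm. apply Rmult_le_compat_r; lra. }
    assert (0 <= (/ (1 - 0)) ^ p) by (apply pow_le; replace (1-0) with 1 by ring; lra).
    lra.
Qed.

(** * The bubble: a logarithm smoothed at scale d *)

Definition jet_bubble (p : nat) (d : R) : jet :=
  janti (jmul (flat_prim (S (2 * p))) (jinv (1 + d))).

Lemma is_jet_bubble p d : 0 < d -> is_jet (1 + d) (jet_bubble p d).
Proof.
  intros Hd. apply is_jet_anti; [lra|].
  apply is_jet_mul; [apply is_jet_flat_prim|apply is_jet_inv].
Qed.

Lemma jflat_bubble p d : jflat (jet_bubble p d).
Proof. apply jflat_anti, jflat_mul, jflat_flat_prim. Qed.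

(** In y, -ln(t + d) is a primitive of 1/(t + d), and J' = g/(t + d) is at least c times that. *)
Lemma jet_bubble_increment p d c x y :
  0 < d -> 0 <= x <= y -> y <= 1 ->
  (forall z, x <= z <= y -> c <= flat_prim (S (2 * p)) 0%nat z) ->
  c * (ln (1 + d - x) - ln (1 + d - y)) <=
  jet_bubble p d 0%nat y - jet_bubble p d 0%nat x.
Proof.
  intros Hd Hx Hy Hc.
  replace (c * _) with (- c * ln (1 + d - y) - - c * ln (1 + d - x)) by ring.
  apply (increment_le _ (fun y => - c * ln (1 + d - y))
    (jet_bubble p d 1%nat) (fun y => c * / (1 + d - y))); [lra| | |].
  - intros z Hz. apply (is_jet_bubble p d Hd 0%nat z). lra.
  - intros z Hz. auto_derive; [lra|]. field; lra.
  - intros z Hz. simpl. unfold jinv. simpl. rewrite Rmult_1_r. unfold Rdiv. rewrite Rmult_1_l.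
    apply Rmult_le_compat_r; [apply Rlt_le, Rinv_0_lt_compat; lra|apply Hc, Hz].
Qed.

Lemma jet_bubble_nonneg p d y : 0 < d -> y <= 1 -> 0 <= jet_bubble p d 0%nat y.
Proof.
  intros Hd Hy. destruct (Rle_dec y 0) as [H|H].
  - rewrite jflat_bubble by exact H; lra.
  - assert (E0 : jet_bubble p d 0%nat 0 = 0) by (apply jflat_bubble; lra).
    assert (0 * (ln (1 + d - 0) - ln (1 + d - y)) <=
      jet_bubble p d 0%nat y - jet_bubble p d 0%nat 0); [|lra].
    apply jet_bubble_increment; [lra|lra|lra|].
    intros z Hz. apply flat_prim_bounds; [lia|lra].
Qed.

(** Only the stretch from 1/2 to 1 is kept: there the nondecreasing g is at least g(1/2) > 0, and
    the profile is already nonnegative at 1/2. *)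
Lemma jet_bubble_center p d : 0 < d ->
  flat_prim (S (2 * p)) 0%nat (1 / 2) * (ln (1 / 2) - ln d) <= jet_bubble p d 0%nat 1.
Proof.
  intros Hd.
  assert (H0 : 0 <= jet_bubble p d 0%nat (1 / 2)) by (apply jet_bubble_nonneg; lra).
  assert (Hg : 0 < flat_prim (S (2 * p)) 0%nat (1 / 2)) by (apply flat_prim_pos; lra).
  assert (HI := jet_bubble_increment p d (flat_prim (S (2 * p)) 0%nat (1 / 2)) (1 / 2) 1
    Hd ltac:(lra) ltac:(lra) ltac:(intros; apply flat_prim_mono; lra)).
  replace (1 + d - 1) with d in HI by ring.
  assert (ln (1 / 2) <= ln (1 + d - 1 / 2)) by (apply ln_le; lra).
  assert (flat_prim (S (2 * p)) 0%nat (1 / 2) * (ln (1 / 2) - ln d) <=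
    flat_prim (S (2 * p)) 0%nat (1 / 2) * (ln (1 + d - 1 / 2) - ln d));
    [apply Rmult_le_compat_l; lra|lra].
Qed.

(** * Bounds on the source of the bubble *)

Lemma iter_mulS_bound t N A j a : 0 <= t <= 1 -> 0 <= A ->
  (forall k, (k <= N)%nat -> Rabs (a k) <= A) ->
  forall k, (k <= N)%nat -> Rabs (Nat.iter j (mulS t) a k) <= (1 + INR N) ^ j * A.
Proof.
  intros Ht HA Ha. induction j as [|j IH]; intros k Hk.
  - simpl. specialize (Ha k Hk). lra.
  - rewrite Nat.iter_succ. unfold mulS at 1.
    assert (H1 := IH k Hk). assert (H2 := IH (pred k) ltac:(lia)).
    set (X := Nat.iter j (mulS t) a k) in *.
    set (Y := Nat.iter j (mulS t) a (pred k)) in *.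
    apply Rle_trans with (Rabs (t * X) + Rabs (INR k * Y)).
    { replace (t * X - INR k * Y) with (t * X + - (INR k * Y)) by ring.
      rewrite <- (Rabs_Ropp (INR k * Y)). apply Rabs_triang. }
    rewrite !Rabs_mult, (Rabs_pos_eq t), (Rabs_pos_eq (INR k)) by (apply pos_INR || lra).
    apply le_INR in Hk. generalize (pos_INR k) (Rabs_pos X) (Rabs_pos Y); intros.
    assert (t * Rabs X <= 1 * ((1 + INR N) ^ j * A)) by (apply Rmult_le_compat; lra).
    assert (INR k * Rabs Y <= INR N * ((1 + INR N) ^ j * A)) by (apply Rmult_le_compat; lra).
    simpl. lra.
Qed.

(* [t x = g - d x] says x = g/(t + d); this is the division of t^j by t + d. *)
Lemma iter_mulS_division t d N a g : 0 <= t <= 1 -> 0 <= d <= 1 ->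
  mulS t a = (fun k => g k - d * a k) ->
  (forall k, (k <= N)%nat -> Rabs (g k) <= 1) ->
  forall j k, (k <= N)%nat ->
  Rabs (Nat.iter j (mulS t) a k - (- d) ^ j * a k) <= INR j * (1 + INR N) ^ j.
Proof.
  intros Ht Hd Ea Hg j; induction j as [|j IH]; intros k Hk.
  - simpl. rewrite Rmult_1_l, Rminus_diag, Rabs_R0. lra.
  - rewrite Nat.iter_succ_r, Ea, iter_mulS_linear.
    assert (Hb := iter_mulS_bound t N 1 j g Ht Rle_0_1 Hg k Hk).
    specialize (IH k Hk).
    set (X := Nat.iter j (mulS t) a k) in *. set (Y := Nat.iter j (mulS t) g k) in *.
    replace (Y - d * X - (- d) ^ S j * a k) with (Y + - (d * (X - (- d) ^ j * a k)))
      by (simpl; ring).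
    apply Rle_trans with (1 := Rabs_triang _ _).
    rewrite Rabs_Ropp, Rabs_mult, (Rabs_pos_eq d) by lra.
    generalize (Rabs_pos (X - (- d) ^ j * a k)) (pos_INR j) (pos_INR N); intros.
    assert (0 <= (1 + INR N) ^ j) by (apply pow_le; lra).
    assert (d * Rabs (X - (- d) ^ j * a k) <= 1 * (INR j * (1 + INR N) ^ j))
      by (apply Rmult_le_compat; lra).
    rewrite S_INR. simpl.
    assert (0 <= INR N * ((1 + INR N) ^ j)) by (apply Rmult_le_pos; lra).
    assert (0 <= INR j * (INR N * ((1 + INR N) ^ j))) by (apply Rmult_le_pos; lra).
    lra.
Qed.

Lemma jinv_bounds d N k y : 0 < d <= 1 -> y <= 1 -> (k <= N)%nat ->
  0 <= jinv (1 + d) k y <= INR (fact N) / d ^ S N.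
Proof.
  intros Hd Hy Hk. unfold jinv.
  assert (H1 : 0 < (1 + d - y) ^ S k) by (apply pow_lt; lra).
  assert (H2 : d ^ S k <= (1 + d - y) ^ S k) by (apply pow_incr; lra).
  assert (H3 : d ^ S N <= d ^ S k).
  { replace (S N) with (S k + (N - k))%nat by lia. rewrite pow_add.
    rewrite <- (Rmult_1_r (d ^ S k)) at 2. apply Rmult_le_compat_l; [apply pow_le; lra|].
    rewrite <- (pow1 (N - k)). apply pow_incr; lra. }
  assert (H4 : 0 < d ^ S N) by (apply pow_lt; lra).
  assert (H5 : INR (fact k) <= INR (fact N)) by (apply le_INR, fact_le, Hk).
  assert (H6 : 0 < INR (fact k)) by apply INR_fact_lt_0.
  split.
  - apply Rlt_le, Rdiv_lt_0_compat; lra.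
  - apply Rmult_le_compat; [lra|apply Rlt_le, Rinv_0_lt_compat, H1|exact H5|].
    apply Rinv_le_contravar; lra.
Qed.

Lemma pow_opp_odd m d : Nat.odd m = true -> (- d) ^ m = - d ^ m.
Proof.
  intros Hm. apply Nat.odd_spec in Hm; destruct Hm as [q ->].
  rewrite Nat.add_comm, !pow_add, !pow_mult. replace ((- d) ^ 2) with (d ^ 2) by ring. ring.
Qed.

(** With m = p + 1 odd, division of t^m by t + d writes t^m J' as -d^m J' plus a polynomial multiple
    of g, whose derivatives up to order 2m-1 are bounded uniformly in d. The other part adds d^m
    D^(2m-1) J' to -L: it is nonnegative, as g and 1/(t + d) have nonnegative derivatives up to that
    order, and it is at most of order d^m d^(-2m). *)
Lemma jet_bubble_lap_bounds p : Nat.odd (S p) = true ->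
  exists K, 0 < K /\ forall d y, 0 < d <= 1 -> y <= 1 ->
  let L := Nat.iter (S p) (jlap (INR (S p))) (jet_bubble p d) 0%nat y in
  - K <= - L <= K / d ^ S p.
Proof.
  intros Hodd. set (N := S (2 * p)).
  set (K1 := INR (S p) * (1 + INR N) ^ S p).
  set (K2 := 2 ^ N * INR (fact N)).
  assert (HK1 : 0 < K1).
  { apply Rmult_lt_0_compat; [apply lt_0_INR; lia|].
    apply pow_lt. generalize (pos_INR N); lra. }
  assert (HK2 : 0 < K2) by (apply Rmult_lt_0_compat; [apply pow_lt; lra|apply INR_fact_lt_0]).
  exists (K1 + K2). split; [lra|]. intros d y Hd Hy L.
  assert (Hdm : 0 < d ^ S p <= 1).
  { split; [apply pow_lt; lra|]. rewrite <- (pow1 (S p)). apply pow_incr; lra. }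
  assert (HK : K1 + K2 <= (K1 + K2) / d ^ S p).
  { rewrite <- (Rdiv_1_r (K1 + K2)) at 1.
    apply Rmult_le_compat_l; [lra|]. apply Rinv_le_contravar; lra. }
  destruct (Rle_dec y 0) as [H|H].
  { replace L with 0; [lra|]. symmetry.
    apply jflat_iter; [apply jflat_lap|apply jflat_bubble|exact H]. }
  set (G := flat_prim N). set (X := jmul G (jinv (1 + d))).
  assert (EL : L = Nat.iter (S p) (mulS (1 - y)) (fun i => X i y) N).
  { unfold L. rewrite iter_jlap_closed. apply iter_jmulT. }
  assert (EX : mulS (1 - y) (fun i => X i y) = fun k => G k y - d * X k y).
  { apply functional_extensionality; intros k.
    change (jmulT X k y = (fun k y => G k y - d * X k y) k y).
    assert (HX : is_jet (1 + d) X)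
      by (apply is_jet_mul; [apply is_jet_flat_prim|apply is_jet_inv]).
    apply (is_jet_unique (1 + d)); [apply is_jet_mulT, HX| | |lra].
    - intros i z Hz. apply: is_derive_minus; [apply (is_jet_flat_prim N (1 + d) i z Hz)|].
      apply: is_derive_scal. apply HX, Hz.
    - intros z Hz. unfold jmulT, mulS, X, jinv; simpl. field. lra. }
  assert (GB : forall k, (k <= N)%nat -> 0 <= G k y <= 1)
    by (intros; apply flat_prim_bounds; [assumption|lra]).
  assert (HD := iter_mulS_division (1 - y) d N (fun i => X i y) (fun i => G i y)
    ltac:(lra) ltac:(lra) EX
    ltac:(intros k Hk; rewrite Rabs_pos_eq; apply GB, Hk) (S p) N (le_n N)).
  rewrite <- EL, pow_opp_odd in HD by exact Hodd. fold K1 in HD.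
  assert (IB : forall i, (i <= N)%nat -> 0 <= jinv (1 + d) i y <= INR (fact N) / d ^ S N)
    by (intros; apply jinv_bounds; auto).
  assert (X0 : 0 <= X N y)
    by (apply jmul_nonneg; intros; [apply GB|apply IB]; assumption).
  assert (X1 : X N y <= 2 ^ N * (1 * (INR (fact N) / d ^ S N)))
    by (apply jmul_le; assumption).
  assert (X2 : d ^ S p * X N y <= K2 / d ^ S p).
  { apply Rle_trans with (d ^ S p * (2 ^ N * (1 * (INR (fact N) / d ^ S N)))).
    - apply Rmult_le_compat_l; lra.
    - right. unfold K2. replace (S N) with (S p + S p)%nat by (unfold N; lia).
      rewrite pow_add. field. lra. }
  assert (X3 : 0 <= d ^ S p * X N y) by (apply Rmult_le_pos; lra).
  assert (K1 <= K1 / d ^ S p).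
  { rewrite <- (Rdiv_1_r K1) at 1.
    apply Rmult_le_compat_l; [lra|]. apply Rinv_le_contravar; lra. }
  apply Rabs_le_between in HD.
  replace ((K1 + K2) / d ^ S p) with (K1 / d ^ S p + K2 / d ^ S p) by (field; lra).
  split; lra.
Qed.

(** * Radial functions and iterated Laplacians *)

Lemma sumR_ext n f g : (forall i, (i < n)%nat -> f i = g i) -> sumR n f = sumR n g.
Proof.
  induction n as [|n IH]; intros H; [reflexivity|].
  simpl. rewrite IH, H; auto with arith.
Qed.

Lemma sumR_plus n f g : sumR n (fun i => f i + g i) = sumR n f + sumR n g.
Proof. induction n as [|n IH]; simpl; [ring|rewrite IH; ring]. Qed.

Lemma sumR_scal n c f : sumR n (fun i => c * f i) = c * sumR n f.
Proof. induction n as [|n IH]; simpl; [ring|rewrite IH; ring]. Qed.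

Lemma sumR_const n c : sumR n (fun _ => c) = INR n * c.
Proof. induction n as [|n IH]; [simpl; ring|]. rewrite S_INR; simpl; rewrite IH; ring. Qed.

Lemma sumR_zero n : sumR n (fun _ => 0) = 0.
Proof. rewrite sumR_const; ring. Qed.

Lemma sumR_le n f g : (forall i, (i < n)%nat -> f i <= g i) -> sumR n f <= sumR n g.
Proof.
  induction n as [|n IH]; intros H; simpl; [lra|].
  apply Rplus_le_compat; auto with arith.
Qed.

Lemma sumR_nonneg n f : (forall i, (i < n)%nat -> 0 <= f i) -> 0 <= sumR n f.
Proof. intros H. rewrite <- (sumR_zero n). now apply sumR_le. Qed.

Lemma sumR_ge_term n f i : (forall i, (i < n)%nat -> 0 <= f i) -> (i < n)%nat ->
  f i <= sumR n f.
Proof.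
  induction n as [|n IH]; intros H Hi; [lia|]. simpl.
  destruct (Nat.eq_dec i n) as [->|Hne].
  - assert (0 <= sumR n f) by (apply sumR_nonneg; auto with arith). lra.
  - assert (f i <= sumR n f) by (apply IH; auto with arith; lia).
    specialize (H n (Nat.lt_succ_diag_r n)). lra.
Qed.

Lemma sumR_swap a b (f : nat -> nat -> R) :
  sumR a (fun i => sumR b (f i)) = sumR b (fun j => sumR a (fun i => f i j)).
Proof.
  induction a as [|a IH]; simpl; [symmetry; apply sumR_zero|].
  rewrite IH, <- sumR_plus. reflexivity.
Qed.

Lemma sumR_trunc a b f : (forall j, (a <= j)%nat -> f j = 0) -> (a <= b)%nat ->
  sumR b f = sumR a f.
Proof.
  intros H Hab; induction Hab as [|b Hab IH]; [reflexivity|].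
  simpl. rewrite IH, H by exact Hab. ring.
Qed.

(** * Points, squared distances and continuity in the first n coordinates *)

Lemma upd_same x i : upd x i (x i) = x.
Proof.
  apply functional_extensionality; intros j; unfold upd.
  destruct (Nat.eqb_spec j i); congruence.
Qed.

Definition dist2 (n : nat) (c x : nat -> R) : R :=
  sumR n (fun i => (x i - c i) * (x i - c i)).

Definition norm2 (n : nat) (x : nat -> R) : R := dist2 n (fun _ => 0) x.

Lemma normn_norm2 n x : normn n x = sqrt (norm2 n x).
Proof. unfold normn, norm2, dist2. f_equal. apply sumR_ext; intros; ring. Qed.

Lemma dist2_nonneg n c x : 0 <= dist2 n c x.
Proof. apply sumR_nonneg; intros; apply Rle_0_sqr. Qed.

Lemma punct_norm2 n x : punct n x <-> 0 < norm2 n x.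
Proof.
  unfold punct. rewrite normn_norm2. split; intros H.
  - destruct (Rle_lt_or_eq_dec _ _ (dist2_nonneg n (fun _ => 0) x)) as [H1|H1]; [exact H1|].
    unfold norm2 in H. rewrite <- H1, sqrt_0 in H. lra.
  - now apply sqrt_lt_R0.
Qed.

Lemma dist2_upd n c x i t : (i < n)%nat ->
  dist2 n c (upd x i t) =
  dist2 n c x - (x i - c i) * (x i - c i) + (t - c i) * (t - c i).
Proof.
  unfold dist2. induction n as [|n IH]; intros Hi; [lia|]. simpl.
  destruct (Nat.eq_dec i n) as [->|Hne].
  - rewrite (sumR_ext n _ (fun i => (x i - c i) * (x i - c i))).
    + unfold upd; rewrite Nat.eqb_refl. ring.
    + intros j Hj; unfold upd. destruct (Nat.eqb_spec j n); [lia|reflexivity].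
  - rewrite IH by lia. unfold upd at 1 2. destruct (Nat.eqb_spec n i); [lia|ring].
Qed.

Lemma is_derive_dist2_upd n c x i : (i < n)%nat ->
  is_derive (fun t => dist2 n c (upd x i t)) (x i) (2 * (x i - c i)).
Proof.
  intros Hi.
  apply is_derive_ext with (fun t => dist2 n c x - (x i - c i) * (x i - c i)
    + (t - c i) * (t - c i)).
  - intros t; symmetry; apply dist2_upd, Hi.
  - auto_derive; [trivial|ring].
Qed.

(** Turns [cont_on] into convergence along a filter, so that limit lemmas for sums, products and
    compositions apply. The filter is built from [normn], which sees only the first n
    coordinates. *)
Definition nearby (n : nat) (U : (nat -> R) -> Prop) (x : nat -> R) :
  ((nat -> R) -> Prop) -> Prop :=
  fun P => exists d, d > 0 /\ forall y, U y -> normn n (fun i => y i - x i) < d -> P y.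

#[global] Instance nearby_filter n U x : Filter (nearby n U x).
Proof.
  split.
  - exists 1; split; [lra|trivial].
  - intros P Q [d [Hd HP]] [e [He HQ]]. exists (Rmin d e); split.
    + apply Rmin_pos; assumption.
    + intros y Uy Hy; split; [apply HP|apply HQ]; auto;
        apply Rlt_le_trans with (1 := Hy); [apply Rmin_l|apply Rmin_r].
  - intros P Q HPQ [d [Hd HP]]. exists d; split; auto.
Qed.

Lemma cont_on_filterlim n U g :
  cont_on n U g <->
  forall x, U x -> filterlim g (nearby n U x) (locally (g x)).
Proof.
  split.
  - intros H x Ux P [eps HP]. destruct (H x Ux eps (cond_pos eps)) as [d [Hd Hy]].
    exists d; split; [exact Hd|]. intros y Uy Hyd. apply HP, Hy; assumption.
  - intros H x Ux eps Heps.
    apply (H x Ux (fun z => Rabs (z - g x) < eps)).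
    exists (mkposreal eps Heps). intros z Hz; exact Hz.
Qed.

Lemma cont_on_const n U c : cont_on n U (fun _ => c).
Proof. apply cont_on_filterlim. intros x _. apply filterlim_const. Qed.

Lemma cont_on_coord n U i : (i < n)%nat -> cont_on n U (fun x => x i).
Proof.
  intros Hi x _ eps Heps. exists eps; split; [exact Heps|]. intros y _ Hy.
  apply Rle_lt_trans with (2 := Hy). unfold normn.
  rewrite <- sqrt_Rsqr_abs. apply sqrt_le_1_alt. unfold Rsqr.
  apply (sumR_ge_term n (fun i => (y i - x i) * (y i - x i)) i); [|exact Hi].
  intros; apply Rle_0_sqr.
Qed.

Lemma cont_on_plus n U f g :
  cont_on n U f -> cont_on n U g -> cont_on n U (fun x => f x + g x).
Proof.
  rewrite !cont_on_filterlim. intros Hf Hg x Ux.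
  eapply filterlim_comp_2; [apply Hf, Ux|apply Hg, Ux|].
  apply (filterlim_plus (f x) (g x)).
Qed.

Lemma cont_on_mult n U f g :
  cont_on n U f -> cont_on n U g -> cont_on n U (fun x => f x * g x).
Proof.
  rewrite !cont_on_filterlim. intros Hf Hg x Ux.
  eapply filterlim_comp_2; [apply Hf, Ux|apply Hg, Ux|].
  apply (filterlim_mult (f x) (g x)).
Qed.

Lemma cont_on_comp n U f h :
  cont_on n U f -> (forall x, U x -> continuous h (f x)) -> cont_on n U (fun x => h (f x)).
Proof.
  rewrite !cont_on_filterlim. intros Hf Hh x Ux.
  apply (filterlim_comp _ _ _ f h _ _ _ (Hf x Ux) (Hh x Ux)).
Qed.

Lemma cont_on_sumR n U N f :
  (forall j, (j < N)%nat -> cont_on n U (f j)) -> cont_on n U (fun x => sumR N (fun j => f j x)).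
Proof.
  induction N as [|N IH]; intros H; simpl; [apply cont_on_const|].
  apply cont_on_plus; auto with arith.
Qed.

Lemma cont_on_dist2 n U c : cont_on n U (dist2 n c).
Proof.
  apply cont_on_sumR. intros j Hj.
  assert (H : cont_on n U (fun x => x j + - c j))
    by (apply cont_on_plus; [now apply cont_on_coord|apply cont_on_const]).
  now apply cont_on_mult.
Qed.

Lemma is_partial_const U i c : is_partial U i (fun _ => c) (fun _ => 0).
Proof. intros x _. apply derivable_pt_lim_const. Qed.

Lemma is_partial_plus U i f g f' g' : is_partial U i f f' -> is_partial U i g g' ->
  is_partial U i (fun x => f x + g x) (fun x => f' x + g' x).
Proof.
  intros Hf Hg x Ux.
  apply (derivable_pt_lim_plus (fun t => f (upd x i t)) (fun t => g (upd x i t))); auto.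
Qed.

Lemma is_partial_mult U i f g f' g' : is_partial U i f f' -> is_partial U i g g' ->
  is_partial U i (fun x => f x * g x) (fun x => f' x * g x + f x * g' x).
Proof.
  intros Hf Hg x Ux.
  assert (H := derivable_pt_lim_mult (fun t => f (upd x i t)) (fun t => g (upd x i t))
    (x i) _ _ (Hf x Ux) (Hg x Ux)).
  cbv beta in H. now rewrite upd_same in H.
Qed.

Lemma is_partial_coord U i j c :
  is_partial U i (fun x => x j - c) (fun _ => if Nat.eqb j i is true then 1 else 0).
Proof.
  intros x _. unfold upd. destruct (Nat.eqb j i); apply is_derive_Reals.
  - auto_derive; [trivial|ring].
  - apply: is_derive_const.
Qed.

Lemma is_partial_sumR U i N f f' : (forall j, (j < N)%nat -> is_partial U i (f j) (f' j)) ->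
  is_partial U i (fun x => sumR N (fun j => f j x)) (fun x => sumR N (fun j => f' j x)).
Proof.
  induction N as [|N IH]; intros H; simpl; [apply is_partial_const|].
  apply is_partial_plus; auto with arith.
Qed.

(** * Functions of 1 - s|x - c|^2 and the classes C^k *)

Definition radial (n : nat) (s : R) (c x : nat -> R) : R := 1 - s * dist2 n c x.

Lemma is_partial_radial n U s c b J k i : is_jet b J ->
  (forall x, U x -> radial n s c x < b) -> (i < n)%nat ->
  is_partial U i (fun x => J k (radial n s c x))
    (fun x => -2 * s * (x i - c i) * J (S k) (radial n s c x)).
Proof.
  intros HJ HU Hi x Ux. apply is_derive_Reals.
  replace (-2 * s * (x i - c i) * J (S k) (radial n s c x)) with
    ((0 - s * (2 * (x i - c i))) * J (S k) (radial n s c x)) by ring.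
  apply (is_derive_comp (J k) (fun t => radial n s c (upd x i t))).
  - rewrite upd_same. apply HJ, HU, Ux.
  - apply: is_derive_minus; [apply: is_derive_const|].
    apply: is_derive_scal. apply is_derive_dist2_upd, Hi.
Qed.

(** [smooth_on] treats one list of indices at a time, and an induction over a list does not close up
    under the product rule; an induction over the order does. *)
Fixpoint Ck (n : nat) (U : (nat -> R) -> Prop) (k : nat) (f : (nat -> R) -> R) : Prop :=
  cont_on n U f /\
  match k with
  | O => True
  | S k => forall i, (i < n)%nat -> exists h, is_partial U i f h /\ Ck n U k h
  end.

Lemma Ck_cont n U k f : Ck n U k f -> cont_on n U f.
Proof. destruct k; intros H; apply H. Qed.

Lemma Ck_pred n U k f : Ck n U (S k) f -> Ck n U k f.
Proof.
  revert f; induction k as [|k IH]; intros f [Hc H]; [split; auto|].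
  split; [exact Hc|]. intros i Hi. destruct (H i Hi) as [h [H1 H2]].
  exists h; split; auto.
Qed.

Lemma Ck_const n U k c : Ck n U k (fun _ => c).
Proof.
  revert c; induction k as [|k IH]; intros c; split; auto using cont_on_const.
  intros i Hi. eexists; split; [apply is_partial_const|apply IH].
Qed.

Lemma Ck_coord n U k j c : (j < n)%nat -> Ck n U k (fun x => x j - c).
Proof.
  intros Hj. assert (Hc : cont_on n U (fun x => x j + - c))
    by (apply cont_on_plus; [now apply cont_on_coord|apply cont_on_const]).
  destruct k; split; auto.
  intros i Hi. eexists; split; [apply is_partial_coord|apply Ck_const].
Qed.

Lemma Ck_plus n U k f g : Ck n U k f -> Ck n U k g -> Ck n U k (fun x => f x + g x).
Proof.
  revert f g; induction k as [|k IH]; intros f g [Cf Hf] [Cg Hg];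
    (split; [now apply cont_on_plus|trivial]).
  intros i Hi. destruct (Hf i Hi) as [f' [F1 F2]], (Hg i Hi) as [g' [G1 G2]].
  eexists; split; [apply is_partial_plus; eassumption|now apply IH].
Qed.

Lemma Ck_mult n U k f g : Ck n U k f -> Ck n U k g -> Ck n U k (fun x => f x * g x).
Proof.
  revert f g; induction k as [|k IH]; intros f g Hf0 Hg0; assert (Hf1 := Hf0);
    assert (Hg1 := Hg0); destruct Hf1 as [Cf Hf], Hg1 as [Cg Hg];
    (split; [now apply cont_on_mult|trivial]).
  intros i Hi. destruct (Hf i Hi) as [f' [F1 F2]], (Hg i Hi) as [g' [G1 G2]].
  eexists; split; [apply is_partial_mult; eassumption|].
  apply Ck_plus; apply IH; auto using Ck_pred.
Qed.

Lemma Ck_radial n U s c b J k l : is_jet b J ->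
  (forall x, U x -> radial n s c x < b) -> Ck n U k (fun x => J l (radial n s c x)).
Proof.
  intros HJ HU; revert l; induction k as [|k IH]; intros l;
    (split; [apply cont_on_comp|trivial]).
  2, 4: intros x Ux; apply (is_jet_continuous b); auto.
  1, 2: apply (cont_on_plus n U (fun _ => 1) (fun x => - (s * dist2 n c x)));
    [apply cont_on_const|].
  1, 2: pose proof (cont_on_mult n U (fun _ => - s) (dist2 n c) (cont_on_const n U (- s))
    (cont_on_dist2 n U c)) as H.
  1, 2: apply (eq_ind _ (cont_on n U) H); apply functional_extensionality; intros; ring.
  intros i Hi. eexists; split; [apply (is_partial_radial n U s c b); eassumption|].
  apply Ck_mult; [|apply IH].
  apply (Ck_mult n U k (fun _ => -2 * s)); [apply Ck_const|now apply Ck_coord].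
Qed.

Lemma smooth_on_of_Ck n U f : (forall k, Ck n U k f) -> smooth_on n U f.
Proof.
  intros H. split; [apply (Ck_cont n U 0), H|].
  intros l. specialize (H (length l)). revert f H.
  induction l as [|i l IH]; intros f H Hl.
  - exists f; split; [constructor|apply H].
  - inversion Hl as [|? ? Hi Hl']; subst. destruct (proj2 H i Hi) as [h [H1 H2]].
    destruct (IH h H2 Hl') as [g [G1 G2]].
    exists g; split; [econstructor; eassumption|exact G2].
Qed.

(** A form of [is_laplacian] with the first partials named: a locally finite sum is differentiated
    one partial at a time, and its second partials come from the sum of the first. *)
Definition lap (n : nat) (U : (nat -> R) -> Prop) (f g : (nat -> R) -> R) : Prop :=
  exists h d : nat -> (nat -> R) -> R,
    (forall i, (i < n)%nat -> is_partial U i f (h i) /\ is_partial U i (h i) (d i)) /\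
    forall x, U x -> g x = sumR n (fun i => d i x).

Lemma iter_laplacian_chain n U (F : nat -> (nat -> R) -> R) k :
  (forall j, lap n U (F j) (F (S j))) -> iter_laplacian n U k (F 0%nat) (F k).
Proof.
  revert F; induction k as [|k IH]; intros F HF; [constructor|].
  apply il_succ with (F 1%nat); [|apply (IH (fun j => F (S j))); auto].
  destruct (HF 0%nat) as [h [d [H1 H2]]]. exists d; split; [|exact H2].
  intros i Hi. destruct (H1 i Hi). econstructor; [eassumption|].
  econstructor; [eassumption|constructor].
Qed.

Lemma lap_plus n U f g f' g' : lap n U f f' -> lap n U g g' ->
  lap n U (fun x => f x + g x) (fun x => f' x + g' x).
Proof.
  intros [h [d [H1 H2]]] [h' [d' [H1' H2']]].
  exists (fun i x => h i x + h' i x), (fun i x => d i x + d' i x). split.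
  - intros i Hi. destruct (H1 i Hi), (H1' i Hi). split; now apply is_partial_plus.
  - intros x Ux. now rewrite H2, H2', sumR_plus.
Qed.

Lemma is_partial_scal U i a f f' : is_partial U i f f' ->
  is_partial U i (fun x => a * f x) (fun x => a * f' x).
Proof.
  intros Hf x Ux. apply (derivable_pt_lim_scal (fun t => f (upd x i t))), Hf, Ux.
Qed.

Lemma lap_scal n U a f f' : lap n U f f' -> lap n U (fun x => a * f x) (fun x => a * f' x).
Proof.
  intros [h [d [H1 H2]]]. exists (fun i x => a * h i x), (fun i x => a * d i x). split.
  - intros i Hi. destruct (H1 i Hi). split; now apply is_partial_scal.
  - intros x Ux. now rewrite H2, sumR_scal.
Qed.

Lemma lap_radial n U s c b J : is_jet b J -> (forall x, U x -> radial n s c x < b) ->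
  lap n U (fun x => J 0%nat (radial n s c x))
    (fun x => 4 * s * jlap (INR n / 2) J 0%nat (radial n s c x)).
Proof.
  intros HJ HU.
  exists (fun i x => -2 * s * (x i - c i) * J 1%nat (radial n s c x)).
  exists (fun i x => -2 * s * J 1%nat (radial n s c x)
     + 4 * s * s * J 2%nat (radial n s c x) * ((x i - c i) * (x i - c i))). split.
  - intros i Hi. split; [now apply (is_partial_radial n U s c b)|].
    assert (H := is_partial_mult U i _ _ _ _
      (is_partial_scal U i (-2 * s) _ _ (is_partial_coord U i i (c i)))
      (is_partial_radial n U s c b J 1 i HJ HU Hi)).
    rewrite Nat.eqb_refl in H.
    intros x Ux. evar_last; [apply (H x Ux)|]. ring.
  - intros x _. rewrite sumR_plus, sumR_const, sumR_scal. fold (dist2 n c x).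
    unfold jlap, lapS, mulS, shiftS, radial. simpl INR. field.
Qed.

(** * Locally finite series *)

(* At every x <> 0 the series of such a [w] is a finite sum. *)
Definition shrinking (n : nat) (w : nat -> (nat -> R) -> R) : Prop :=
  forall j x, / INR (S j) < norm2 n x -> w j x = 0.

Definition cutoff (r : R) : nat := Z.to_nat (up (/ r)).

Definition lsum (n : nat) (w : nat -> (nat -> R) -> R) (x : nat -> R) : R :=
  sumR (cutoff (norm2 n x)) (fun j => w j x).

Lemma cutoff_lt r j : 0 < r -> (cutoff r <= j)%nat -> / INR (S j) < r.
Proof.
  intros Hr Hj. unfold cutoff in Hj.
  assert (Hi : 0 < / r) by (apply Rinv_0_lt_compat, Hr).
  assert (H : / r < INR (S j)).
  { destruct (archimed (/ r)) as [H1 _]. apply Rlt_le_trans with (1 := H1).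
    rewrite INR_IZR_INZ. apply IZR_le.
    assert (0 < up (/ r))%Z by (apply lt_IZR; lra). lia. }
  rewrite <- (Rinv_inv r). apply Rinv_lt_contravar; [apply Rmult_lt_0_compat; lra|exact H].
Qed.

(** The number of terms in [lsum] depends on x. Terms past the cutoff of r vanish wherever |x|^2 >=
    r, so one N serves on a whole neighbourhood, where the series is differentiated as a finite
    sum. *)
Lemma lsum_eq n w r x N : shrinking n w -> 0 < r <= norm2 n x -> (cutoff r <= N)%nat ->
  lsum n w x = sumR N (fun j => w j x).
Proof.
  intros Hw Hr HN. unfold lsum.
  assert (H : forall j, (cutoff (norm2 n x) <= j)%nat \/ (N <= j)%nat -> w j x = 0).
  { intros j [Hj|Hj]; apply Hw.
    - apply cutoff_lt; [lra|exact Hj].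
    - apply Rlt_le_trans with r; [apply cutoff_lt; [lra|lia]|lra]. }
  destruct (Nat.le_ge_cases (cutoff (norm2 n x)) N);
    [symmetry|]; apply sumR_trunc; auto.
Qed.

Lemma norm2_near_upd n x i r : (i < n)%nat -> r < norm2 n x ->
  locally (x i) (fun t => r < norm2 n (upd x i t)).
Proof.
  intros Hi Hr.
  assert (Hc : continuous (fun t => norm2 n (upd x i t)) (x i)).
  { apply: ex_derive_continuous. eexists. apply is_derive_dist2_upd, Hi. }
  apply (Hc (fun z => r < z)). rewrite upd_same. apply (open_gt r), Hr.
Qed.

Lemma norm2_nearby n x r : punct n x -> r < norm2 n x ->
  nearby n (punct n) x (fun y => r < norm2 n y).
Proof.
  intros Ux Hr.
  apply (proj1 (cont_on_filterlim n (punct n) (norm2 n))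
    (cont_on_dist2 n (punct n) (fun _ => 0)) x Ux (fun z => r < z)).
  apply (open_gt r), Hr.
Qed.

Lemma norm2_half n x : punct n x -> 0 < norm2 n x / 2 < norm2 n x.
Proof. intros H; apply punct_norm2 in H; lra. Qed.

(** The region where a term is required to vanish is open, so its partials vanish there too. *)
Lemma shrinking_partial n w h i : shrinking n w -> (i < n)%nat ->
  (forall j, is_partial (punct n) i (w j) (h j)) -> shrinking n h.
Proof.
  intros Hw Hi Hh j x Hx.
  assert (Ux : punct n x).
  { apply punct_norm2. apply Rlt_trans with (2 := Hx), Rinv_0_lt_compat, lt_0_INR; lia. }
  specialize (Hh j x Ux). apply is_derive_Reals in Hh.
  rewrite <- (is_derive_unique _ _ _ Hh).
  apply is_derive_unique. apply is_derive_ext_loc with (fun _ => 0); [|apply: is_derive_const].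
  apply filter_imp with (2 := norm2_near_upd n x i _ Hi Hx).
  intros t Ht. symmetry. apply Hw, Ht.
Qed.

Lemma is_partial_lsum n w h i : shrinking n w -> (i < n)%nat ->
  (forall j, is_partial (punct n) i (w j) (h j)) ->
  is_partial (punct n) i (lsum n w) (lsum n h).
Proof.
  intros Hw Hi Hh x Ux. destruct (norm2_half n x Ux) as [H0 H1].
  set (N := cutoff (norm2 n x / 2)).
  rewrite (lsum_eq n h (norm2 n x / 2) x N);
    [|now apply (shrinking_partial n w h i)|lra|apply le_n].
  apply is_derive_Reals.
  apply is_derive_ext_loc with (fun t => sumR N (fun j => w j (upd x i t))).
  - apply filter_imp with (2 := norm2_near_upd n x i _ Hi H1).
    intros t Ht. symmetry. apply (lsum_eq n w (norm2 n x / 2)); [exact Hw|lra|apply le_n].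
  - apply is_derive_Reals. apply (is_partial_sumR (punct n) i N w h); auto.
Qed.

Lemma cont_on_lsum n w : shrinking n w -> (forall j, cont_on n (punct n) (w j)) ->
  cont_on n (punct n) (lsum n w).
Proof.
  intros Hw Hc. apply cont_on_filterlim. intros x Ux.
  destruct (norm2_half n x Ux) as [H0 H1].
  set (N := cutoff (norm2 n x / 2)).
  assert (E : forall y, norm2 n x / 2 < norm2 n y -> sumR N (fun j => w j y) = lsum n w y).
  { intros y Hy. symmetry. apply (lsum_eq n w (norm2 n x / 2)); [exact Hw|lra|apply le_n]. }
  rewrite <- E by exact H1.
  apply filterlim_ext_loc with (fun y => sumR N (fun j => w j y)).
  - apply filter_imp with (2 := norm2_nearby n x _ Ux H1). exact E.
  - apply (proj1 (cont_on_filterlim n (punct n) (fun y => sumR N (fun j => w j y)))); [|exact Ux].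
    now apply cont_on_sumR.
Qed.


Lemma Ck_lsum n k w : shrinking n w -> (forall j, Ck n (punct n) k (w j)) ->
  Ck n (punct n) k (lsum n w).
Proof.
  revert w; induction k as [|k IH]; intros w Hw Hk;
    (split; [apply cont_on_lsum; [exact Hw|intros j; eapply Ck_cont, Hk]|trivial]).
  intros i Hi.
  destruct (functional_choice (fun j h => is_partial (punct n) i (w j) h /\ Ck n (punct n) k h)
    (fun j => proj2 (Hk j) i Hi)) as [h Hh].
  exists (lsum n h). split.
  - apply is_partial_lsum; auto. apply Hh.
  - apply IH; [|apply Hh]. apply (shrinking_partial n w h i); auto. apply Hh.
Qed.

Lemma shrinking_sumR n w d : (forall i, (i < n)%nat -> shrinking n (fun j => d j i)) ->
  (forall j x, punct n x -> w j x = sumR n (fun i => d j i x)) -> shrinking n w.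
Proof.
  intros Hd Hw j x Hx. rewrite Hw.
  - rewrite <- (sumR_zero n). apply sumR_ext. intros i Hi. now apply (Hd i Hi j x).
  - apply punct_norm2. apply Rlt_trans with (2 := Hx), Rinv_0_lt_compat, lt_0_INR; lia.
Qed.

Lemma lap_lsum n w g : shrinking n w -> (forall j, lap n (punct n) (w j) (g j)) ->
  shrinking n g /\ lap n (punct n) (lsum n w) (lsum n g).
Proof.
  intros Hw Hl.
  destruct (functional_choice _ Hl) as [h Hh].
  destruct (functional_choice _ Hh) as [d Hd]. clear Hl Hh.
  assert (Sh : forall i, (i < n)%nat -> shrinking n (fun j => h j i)).
  { intros i Hi. apply (shrinking_partial n w _ i); auto.
    intros j. apply (proj1 (Hd j) i Hi). }
  assert (Sd : forall i, (i < n)%nat -> shrinking n (fun j => d j i)).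
  { intros i Hi. apply (shrinking_partial n (fun j => h j i) _ i); auto.
    intros j. apply (proj1 (Hd j) i Hi). }
  split.
  - apply (shrinking_sumR n g d Sd). intros j; apply (proj2 (Hd j)).
  - exists (fun i => lsum n (fun j => h j i)), (fun i => lsum n (fun j => d j i)). split.
    + intros i Hi. split; apply is_partial_lsum; auto; intros j; apply (proj1 (Hd j) i Hi).
    + intros x Ux. unfold lsum. rewrite sumR_swap. apply sumR_ext. intros j _.
      apply (proj2 (Hd j) x Ux).
Qed.

(** * The solution *)

(** The k-th iterated Laplacian of J(1 - s|x - c|^2) in dimension 2(p + 1); each Laplacian brings a
    factor 4s. *)
Definition radial_lap (p : nat) (s : R) (c : nat -> R) (J : jet) (k : nat) (x : nat -> R) : R :=
  (4 * s) ^ k * Nat.iter k (jlap (INR (S p))) J 0%nat (radial (2 * S p) s c x).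

Lemma lap_radial_lap p U s c b J k : is_jet b J ->
  (forall x, U x -> radial (2 * S p) s c x < b) ->
  lap (2 * S p) U (radial_lap p s c J k) (radial_lap p s c J (S k)).
Proof.
  intros HJ HU. unfold radial_lap.
  assert (H := lap_radial (2 * S p) U s c b (Nat.iter k (jlap (INR (S p))) J)
    (is_jet_iter b _ (is_jet_lap b (INR (S p))) k J HJ) HU).
  replace (INR (2 * S p) / 2) with (INR (S p)) in H
    by (rewrite mult_INR; simpl (INR 2); field).
  apply (lap_scal _ _ ((4 * s) ^ k)) in H.
  apply (eq_ind _ (lap _ _ _) H). apply functional_extensionality; intros x.
  rewrite Nat.iter_succ. simpl pow. ring.
Qed.

Lemma Ck_radial_lap p U s c b J k l : is_jet b J ->
  (forall x, U x -> radial (2 * S p) s c x < b) ->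
  Ck (2 * S p) U l (radial_lap p s c J k).
Proof.
  intros HJ HU. apply (Ck_mult _ _ _ (fun _ => (4 * s) ^ k)); [apply Ck_const|].
  apply (Ck_radial _ _ s c b); [|exact HU].
  apply is_jet_iter; [apply is_jet_lap|exact HJ].
Qed.

(* A smoothed logarithm around [c], |c|^2 = a, whose source is nonnegative up to a bounded
   error inside the ball |x - c|^2 < a/4; the error is absorbed by the positive source of
   the second term, radial around the origin. *)
Definition piece (p : nat) (K a d : R) (c : nat -> R) (k : nat) (x : nat -> R) : R :=
  (/ a) ^ p * (radial_lap p (4 / a) c (jet_bubble p d) k x +
    - K * radial_lap p (/ (5 * a)) (fun _ => 0) (jet_shell p) k x).

Lemma radial_le n s c x : 0 <= s -> radial n s c x <= 1.
Proof.
  intros Hs. unfold radial. generalize (Rmult_le_pos _ _ Hs (dist2_nonneg n c x)); lra.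
Qed.

Lemma radial_lt1 n s x : 0 < s -> punct n x -> radial n s (fun _ => 0) x < 1.
Proof.
  intros Hs Hx. apply punct_norm2 in Hx. unfold radial. fold (norm2 n x).
  generalize (Rmult_lt_0_compat _ _ Hs Hx); lra.
Qed.

Lemma lap_piece p K a d c k : 0 < a -> 0 < d ->
  lap (2 * S p) (punct (2 * S p)) (piece p K a d c k) (piece p K a d c (S k)).
Proof.
  intros Ha Hd. assert (0 < 4 / a) by (apply Rdiv_lt_0_compat; lra).
  assert (0 < / (5 * a)) by (apply Rinv_0_lt_compat; lra).
  unfold piece. apply lap_scal, lap_plus; [|apply lap_scal].
  - apply (lap_radial_lap p _ _ _ (1 + d)); [apply is_jet_bubble, Hd|].
    intros x _. generalize (radial_le (2 * S p) (4 / a) c x); lra.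
  - apply (lap_radial_lap p _ _ _ 1); [apply is_jet_shell|].
    intros x Hx. now apply radial_lt1.
Qed.

Lemma Ck_piece p K a d c k l : 0 < a -> 0 < d ->
  Ck (2 * S p) (punct (2 * S p)) l (piece p K a d c k).
Proof.
  intros Ha Hd. assert (0 < 4 / a) by (apply Rdiv_lt_0_compat; lra).
  assert (0 < / (5 * a)) by (apply Rinv_0_lt_compat; lra).
  unfold piece. apply (Ck_mult _ _ _ (fun _ => (/ a) ^ p)); [apply Ck_const|].
  apply Ck_plus; [|apply (Ck_mult _ _ _ (fun _ => - K)); [apply Ck_const|]].
  - apply (Ck_radial_lap p _ _ _ (1 + d)); [apply is_jet_bubble, Hd|].
    intros x _. generalize (radial_le (2 * S p) (4 / a) c x); lra.
  - apply (Ck_radial_lap p _ _ _ 1); [apply is_jet_shell|].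
    intros x Hx. now apply radial_lt1.
Qed.

(** In each coordinate the difference of the two sides is (x_i - 2c_i)^2. *)
Lemma norm2_le_dist2 n c x : norm2 n x <= 2 * dist2 n c x + 2 * norm2 n c.
Proof.
  unfold norm2, dist2. rewrite <- !sumR_scal, <- sumR_plus. apply sumR_le. intros i _.
  generalize (Rle_0_sqr (x i - 2 * c i)). unfold Rsqr. lra.
Qed.

(** The shell lives in |x|^2 < 5a. Beyond it, |x - c|^2 >= 3a/2 > a/4, so x is outside the ball of
    the bubble as well. *)
Lemma piece_far p K a d c k x : 0 < a -> norm2 (2 * S p) c = a ->
  5 * a <= norm2 (2 * S p) x -> piece p K a d c k x = 0.
Proof.
  intros Ha Hc Hx. assert (Hi : 0 < / a) by (apply Rinv_0_lt_compat, Ha).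
  assert (HT := norm2_le_dist2 (2 * S p) c x). rewrite Hc in HT.
  unfold piece, radial_lap.
  rewrite (jflat_iter _ (jflat_lap _) k (jet_bubble p d) (jflat_bubble p d)).
  - rewrite (jflat_iter _ (jflat_lap _) k (jet_shell p) (jflat_shell p)); [ring|].
    unfold radial. fold (norm2 (2 * S p) x).
    assert (/ (5 * a) * (5 * a) <= / (5 * a) * norm2 (2 * S p) x).
    { apply Rmult_le_compat_l; [apply Rlt_le, Rinv_0_lt_compat; lra|exact Hx]. }
    rewrite Rinv_l in *; lra.
  - unfold radial.
    assert (4 / a * (3 / 2 * a) <= 4 / a * dist2 (2 * S p) c x).
    { apply Rmult_le_compat_l; [apply Rlt_le, Rdiv_lt_0_compat; lra|lra]. }
    replace (4 / a * (3 / 2 * a)) with 6 in * by (field; lra). lra.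
Qed.

(** At t = |x|^2/(5a) the bound t^(-p) on the shell cancels the factor a^(-p): the loss is a
    multiple of |x|^(-2p) independent of a, so one multiple of |x|^(-2p) can pay for all pieces. *)
Lemma piece_lower p K a d c x : (1 <= p)%nat -> 0 < a -> 0 <= K -> 0 < norm2 (2 * S p) x ->
  (/ a) ^ p * jet_bubble p d 0%nat (radial (2 * S p) (4 / a) c x)
    - K * 5 ^ p * (/ norm2 (2 * S p) x) ^ p <= piece p K a d c 0 x.
Proof.
  intros Hp Ha HK Hx.
  assert (E : forall s c J, radial_lap p s c J 0 x = J 0%nat (radial (2 * S p) s c x))
    by (intros; apply Rmult_1_l).
  unfold piece; rewrite !E.
  assert (Hy : radial (2 * S p) (/ (5 * a)) (fun _ => 0) x < 1).
  { apply radial_lt1; [apply Rinv_0_lt_compat; lra|now apply punct_norm2]. }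
  destruct (jet_shell_bounds p _ Hp Hy) as [_ HB].
  unfold radial in HB at 2. fold (norm2 (2 * S p) x) in HB.
  replace (1 - (1 - / (5 * a) * norm2 (2 * S p) x)) with (/ (5 * a) * norm2 (2 * S p) x)
    in HB by ring.
  assert (Hap : 0 < (/ a) ^ p) by (apply pow_lt, Rinv_0_lt_compat, Ha).
  apply (Rmult_le_compat_l ((/ a) ^ p * K)) in HB; [|apply Rmult_le_pos; lra].
  replace ((/ a) ^ p * K * (/ (/ (5 * a) * norm2 (2 * S p) x)) ^ p) with
    (K * 5 ^ p * (/ norm2 (2 * S p) x) ^ p) in HB; [lra|].
  rewrite Rmult_assoc, <- Rpow_mult_distr.
  rewrite (Rmult_comm _ K), Rmult_assoc, <- Rpow_mult_distr. do 2 f_equal. field. lra.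
Qed.

(** Where |x - c|^2 < a/4 one has |x|^2 <= 5a/2, so the shell variable is at least 1/2 and the shell
    source at least (4/(5a))^m exp(-2), with m = p + 1. The negative part of the bubble source is at
    most K0 (16/a)^m; the quotient 16/(4/5) = 20 explains K. Elsewhere the bubble has no source and
    the sign of the shell decides. *)
Lemma piece_source_bounds p : Nat.odd (S p) = true ->
  exists K B, 0 < K /\ 0 < B /\ forall a d c x,
  0 < a -> 0 < d <= 1 -> norm2 (2 * S p) c = a -> punct (2 * S p) x ->
  0 <= - piece p K a d c (S p) x <= (/ a) ^ p * (B * (/ a) ^ S p * / d ^ S p).
Proof.
  intros Hodd. destruct (jet_bubble_lap_bounds p Hodd) as [K0 [HK0 Hb]].
  set (K := K0 * 20 ^ S p * exp 2).
  assert (HK : 0 < K).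
  { apply Rmult_lt_0_compat; [apply Rmult_lt_0_compat; [exact HK0|apply pow_lt; lra]|apply exp_pos]. }
  exists K, (16 ^ S p * K0 + K).
  assert (H16 : 0 < 16 ^ S p) by (apply pow_lt; lra).
  split; [exact HK|]. split; [generalize (Rmult_lt_0_compat _ _ H16 HK0); lra|].
  intros a d c x Ha Hd Hc Hx.
  assert (Ha' : 0 < / a) by (apply Rinv_0_lt_compat, Ha).
  assert (Hap : 0 < (/ a) ^ p) by (apply pow_lt, Ha').
  assert (Ham : 0 < (/ a) ^ S p) by (apply pow_lt, Ha').
  set (X := radial_lap p (4 / a) c (jet_bubble p d) (S p) x).
  set (Y := radial_lap p (/ (5 * a)) (fun _ => 0) (jet_shell p) (S p) x).
  cut (0 <= - (X + - K * Y) <= (16 ^ S p * K0 + K) * (/ a) ^ S p * / d ^ S p).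
  { intros HV. unfold piece. fold X Y.
    replace (- ((/ a) ^ p * (X + - K * Y))) with ((/ a) ^ p * - (X + - K * Y)) by ring.
    split; [apply Rmult_le_pos; lra|apply Rmult_le_compat_l; lra]. }
  set (yV := radial (2 * S p) (4 / a) c x).
  set (yH := radial (2 * S p) (/ (5 * a)) (fun _ => 0) x).
  assert (HyH : yH < 1) by (apply radial_lt1; [apply Rinv_0_lt_compat; lra|exact Hx]).
  assert (HyV : yV <= 1) by (apply radial_le, Rlt_le, Rdiv_lt_0_compat; lra).
  assert (EY : Y = (4 / 5) ^ S p * (/ a) ^ S p * flat_exp 0 yH).
  { unfold Y, radial_lap. rewrite jet_shell_lap by exact HyH.
    rewrite <- Rpow_mult_distr. f_equal. f_equal. field; lra. }
  assert (H45 : 0 < (4 / 5) ^ S p <= 1).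
  { split; [apply pow_lt; lra|]. rewrite <- (pow1 (S p)). apply pow_incr; lra. }
  assert (Hfe := flat_exp0_bounds yH).
  specialize (Hb d yV Hd HyV). cbv zeta in Hb.
  set (L := Nat.iter (S p) (jlap (INR (S p))) (jet_bubble p d) 0%nat yV) in *.
  assert (EX : X = 16 ^ S p * (/ a) ^ S p * L).
  { unfold X, radial_lap. fold yV. fold L. rewrite <- Rpow_mult_distr.
    f_equal. f_equal. field; lra. }
  assert (H45a : 0 < (4 / 5) ^ S p * (/ a) ^ S p) by (apply Rmult_lt_0_compat; lra).
  assert (H16a : 0 < 16 ^ S p * (/ a) ^ S p) by (apply Rmult_lt_0_compat; lra).
  assert (HdS : 1 <= / d ^ S p).
  { rewrite <- Rinv_1. apply Rinv_le_contravar; [apply pow_lt; lra|].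
    rewrite <- (pow1 (S p)). apply pow_incr; lra. }
  split.
  - destruct (Rle_dec yV 0) as [H0|H0].
    + assert (L0 : L = 0)
        by (apply jflat_iter; [apply jflat_lap|apply jflat_bubble|exact H0]).
      rewrite EX, EY, L0.
      assert (0 <= K * ((4 / 5) ^ S p * (/ a) ^ S p * flat_exp 0 yH))
        by (apply Rmult_le_pos; [lra|apply Rmult_le_pos; lra]).
      lra.
    + assert (HyH2 : 1 / 2 <= yH).
      { assert (HT := norm2_le_dist2 (2 * S p) c x). rewrite Hc in HT.
        assert (HD : dist2 (2 * S p) c x <= a / 4).
        { unfold yV, radial in H0.
          apply Rmult_le_reg_l with (4 / a); [apply Rdiv_lt_0_compat; lra|].
          replace (4 / a * (a / 4)) with 1 by (field; lra). lra. }
        unfold yH, radial. fold (norm2 (2 * S p) x).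
        assert (/ (5 * a) * norm2 (2 * S p) x <= / (5 * a) * (5 / 2 * a)).
        { apply Rmult_le_compat_l; [apply Rlt_le, Rinv_0_lt_compat; lra|lra]. }
        replace (/ (5 * a) * (5 / 2 * a)) with (1 / 2) in * by (field; lra). lra. }
      assert (Hf2 : exp (- 2) <= flat_exp 0 yH).
      { unfold flat_exp. destruct Rle_dec; [lra|]. simpl. rewrite Rmult_1_l.
        assert (Hi : / yH <= 2).
        { replace 2 with (/ (1 / 2)) by field. apply Rinv_le_contravar; lra. }
        destruct (Rle_lt_or_eq_dec _ _ Hi) as [Hlt|Heq]; [|right; f_equal; lra].
        apply Rlt_le, exp_increasing; lra. }
      assert (E1 : 16 ^ S p * (/ a) ^ S p * K0 <= K * Y).
      { rewrite EY.
        apply Rle_trans with (K * ((4 / 5) ^ S p * (/ a) ^ S p * exp (- 2))).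
        - right. unfold K. replace (exp (- 2)) with (/ exp 2) by (rewrite <- exp_Ropp; f_equal; lra).
          replace (16 ^ S p) with (20 ^ S p * (4 / 5) ^ S p)
            by (rewrite <- Rpow_mult_distr; f_equal; field).
          generalize (exp_pos 2); intros. field. lra.
        - apply Rmult_le_compat_l; [lra|]. apply Rmult_le_compat_l; lra. }
      assert (E2 : 16 ^ S p * (/ a) ^ S p * L <= 16 ^ S p * (/ a) ^ S p * K0)
        by (apply Rmult_le_compat_l; lra).
      rewrite EX. lra.
  - assert (E1 : 16 ^ S p * (/ a) ^ S p * (- L) <= 16 ^ S p * (/ a) ^ S p * (K0 / d ^ S p))
      by (apply Rmult_le_compat_l; lra).
    assert (E2 : K * Y <= K * (/ a) ^ S p * / d ^ S p).
    { rewrite EY, (Rmult_assoc K). apply Rmult_le_compat_l; [lra|].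
      apply Rle_trans with ((/ a) ^ S p * 1); [|apply Rmult_le_compat_l; lra].
      rewrite Rmult_1_r.
      apply Rle_trans with ((4 / 5) ^ S p * (/ a) ^ S p * 1); [apply Rmult_le_compat_l; lra|].
      rewrite Rmult_1_r. rewrite <- (Rmult_1_l ((/ a) ^ S p)) at 2.
      apply Rmult_le_compat_r; lra. }
    rewrite EX. unfold Rdiv in E1. lra.
Qed.

Lemma radial_lap_base p x : punct (2 * S p) x ->
  radial_lap p 1 (fun _ => 0) (jet_base p) (S p) x = 0 /\
  radial_lap p 1 (fun _ => 0) (jet_base p) 0 x = (/ norm2 (2 * S p) x) ^ p.
Proof.
  intros Hx. assert (H1 : radial (2 * S p) 1 (fun _ => 0) x < 1) by (apply radial_lt1; [lra|exact Hx]).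
  unfold radial_lap. split.
  - rewrite jet_base_lap by exact H1. ring.
  - change (Nat.iter 0 (jlap (INR (S p))) (jet_base p)) with (jet_base p).
    rewrite jet_base_0. unfold radial. fold (norm2 (2 * S p) x).
    replace (1 - (1 - 1 * norm2 (2 * S p) x)) with (norm2 (2 * S p) x) by ring.
    rewrite pow_O. ring.
Qed.

(** * Weights, scales and the choice of radii *)

Lemma sumR_half_le N : sumR N (fun j => (/ 2) ^ S j) <= 1.
Proof.
  assert (E : sumR N (fun j => (/ 2) ^ S j) = 1 - (/ 2) ^ N).
  { induction N as [|N IH]; [simpl; ring|]. cbn [sumR]. rewrite IH. simpl. field. }
  rewrite E. generalize (pow_le (/ 2) N ltac:(lra)). lra.
Qed.

Lemma sumR_weights_le N w f A : (forall j, (j < N)%nat -> f j <= w * (/ 2) ^ S j * A) ->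
  0 <= w * A -> sumR N f <= w * A.
Proof.
  intros Hf HA. apply Rle_trans with (1 := sumR_le N _ _ Hf).
  rewrite (sumR_ext N _ (fun j => (w * A) * (/ 2) ^ S j)) by (intros; ring).
  rewrite sumR_scal. generalize (Rmult_le_compat_l _ _ _ HA (sumR_half_le N)). lra.
Qed.

(* With d = a^(g/m), g = p lambda - (2p+1), the bubble source a^(-p-m) d^(-m) is exactly
   a^(-p lambda), which |x|^2 < 5 a turns into a multiple of |x|^(-2 p lambda). *)
Lemma source_scale p lambda a rho : 0 < a < 1 -> 0 < rho < 5 * a -> 0 <= lambda ->
  (/ a) ^ p * ((/ a) ^ S p *
     / Rpower a ((INR p * lambda - INR (2 * p + 1)) / INR (S p)) ^ S p) <=
  Rpower 5 (INR p * lambda) * Rpower ((/ rho) ^ p) lambda.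
Proof.
  intros Ha Hr Hl. assert (HS : INR (S p) <> 0) by (apply not_0_INR; lia).
  assert (Hi : 0 < / a) by (apply Rinv_0_lt_compat; lra).
  assert (Hir : 0 < / rho) by (apply Rinv_0_lt_compat; lra).
  assert (Ea : forall z, / Rpower a z = Rpower (/ a) z).
  { intros z. rewrite <- Rpower_Ropp. unfold Rpower. rewrite ln_Rinv by lra. f_equal; ring. }
  rewrite <- (Rpower_pow (S p) (Rpower a _)) by apply exp_pos.
  rewrite Rpower_mult, Ea, <- !Rpower_pow by exact Hi.
  rewrite <- !Rpower_plus.
  replace (INR p + (INR (S p) + (INR p * lambda - INR (2 * p + 1)) / INR (S p) * INR (S p)))
    with (INR p * lambda).
  2:{ replace (2 * p + 1)%nat with (p + S p)%nat by lia. rewrite plus_INR. field. exact HS. }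
  rewrite <- Rpower_pow by exact Hir. rewrite Rpower_mult.
  rewrite Rpower_mult_distr by lra.
  apply Rle_Rpower_l; [apply Rmult_le_pos; [apply pos_INR|exact Hl]|].
  split; [exact Hi|].
  apply Rmult_le_reg_l with (a * rho); [apply Rmult_lt_0_compat; lra|].
  replace (a * rho * / a) with rho by (field; lra).
  replace (a * rho * (5 * / rho)) with (5 * a) by (field; lra). lra.
Qed.

(** The bound 1/(5(j+1)) puts the j-th piece inside |x|^2 <= 1/(j+1), since 5 r_j^2 <= 5 r_j. The
    bound 4^(-j) is to beat weights of size 2^(-j). The bound on -ln r_j is to absorb additive
    constants in the logarithms. *)
Lemma vanishing_radii (phi : R -> R) (l : R) :
  (forall eps, eps > 0 -> exists d, d > 0 /\ forall r, 0 < r < d -> Rabs (phi r) < eps) ->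
  exists r : nat -> R, forall j, 0 < r j < 1 /\ r j <= / (5 * INR (S j)) /\
    Rabs (phi (r j)) < (/ 4) ^ j /\ l <= - ln (r j).
Proof.
  intros Hphi. apply functional_choice with (R := fun j r => 0 < r < 1 /\
    r <= / (5 * INR (S j)) /\ Rabs (phi r) < (/ 4) ^ j /\ l <= - ln r).
  intros j. destruct (Hphi ((/ 4) ^ j)) as [d [Hd H]]; [apply pow_lt; lra|].
  assert (HS : 0 < INR (S j)) by (apply lt_0_INR; lia).
  assert (H5 : 0 < / (5 * INR (S j))) by (apply Rinv_0_lt_compat; lra).
  assert (He := exp_pos (- l)).
  set (r := Rmin (Rmin 1 d) (Rmin (/ (5 * INR (S j))) (exp (- l))) / 2).
  assert (Hr0 : 0 < r) by (unfold r; repeat apply Rmin_case; lra).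
  assert (H1 : 2 * r <= 1 /\ 2 * r <= d /\ 2 * r <= / (5 * INR (S j)) /\ 2 * r <= exp (- l)).
  { unfold r. set (A := Rmin 1 d). set (B := Rmin (/ (5 * INR (S j))) (exp (- l))).
    generalize (Rmin_l A B) (Rmin_r A B) (Rmin_l 1 d) (Rmin_r 1 d)
      (Rmin_l (/ (5 * INR (S j))) (exp (- l))) (Rmin_r (/ (5 * INR (S j))) (exp (- l))).
    fold A B. lra. }
  exists r. split; [lra|]. split; [lra|]. split; [apply H; lra|].
  assert (ln r <= ln (exp (- l))) by (apply ln_le; lra). rewrite ln_exp in *. lra.
Qed.

Definition axis_point (r : R) : nat -> R := fun i => match i with O => r | S _ => 0 end.

Lemma norm2_axis_point n r : norm2 (S n) (axis_point r) = r * r.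
Proof.
  unfold norm2, dist2. induction n as [|n IH]; simpl in *; [ring|]. rewrite IH. ring.
Qed.

Lemma normn_axis_point n r : 0 <= r -> normn (S n) (axis_point r) = r.
Proof. intros Hr. rewrite normn_norm2, norm2_axis_point. now apply sqrt_square. Qed.

Lemma dist2_self n c : dist2 n c c = 0.
Proof.
  unfold dist2. rewrite <- (sumR_zero n). apply sumR_ext; intros; ring.
Qed.

Theorem theorem1p8 (m : nat) (lambda : R) (phi : R -> R)
  (Hm3 : (3 <= m)%nat) (Hodd : Nat.odd m = true)
  (Hlam : lambda > (2 * INR (2 * m) - 2) / (INR (2 * m) - 2))
  (Hphi_range : forall r, 0 < r < 1 -> 0 < phi r < 1)
  (Hphi_cont : forall r, 0 < r < 1 -> continuity_pt phi r)
  (Hphi_lim : forall eps, eps > 0 -> exists d, d > 0 /\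
       forall r, 0 < r < d -> Rabs (phi r) < eps) :
  exists u : (nat -> R) -> R,
    smooth_on (2 * m) (punct (2 * m)) u /\
    (forall x, punct (2 * m) x -> u x > 0) /\
    (exists g, iter_laplacian (2 * m) (punct (2 * m)) m u g /\
       forall x, punct (2 * m) x -> 0 <= - g x <= Rpower (u x) lambda) /\
    (* u(x) <> O(phi(|x|) |x|^{-(n-2)} log(5/|x|)) as x -> 0, i.e. limsup of the ratio is +oo *)
    (forall M d, d > 0 -> exists x,
       0 < normn (2 * m) x < Rmin d 1 /\
       u x / (phi (normn (2 * m) x) / normn (2 * m) x ^ (2 * m - 2)
              * ln (5 / normn (2 * m) x)) > M).
Proof.
  destruct m as [|p]; [lia|].
  set (n := (2 * S p)%nat) in *.
  assert (Hp : 2 <= INR p) by (apply (le_INR 2); lia).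
  (* Here m = p + 1 and n - 2 = 2p; the hypothesis on lambda says exactly that p lambda exceeds p +
     m = 2p + 1. *)
  set (gam := INR p * lambda - INR (2 * p + 1)).
  assert (Hgam : 0 < gam /\ 0 < lambda).
  { assert (En : INR n = 2 * INR p + 2)
      by (unfold n; rewrite mult_INR, (S_INR p); simpl (INR 2); ring).
    rewrite En in Hlam.
    replace ((2 * (2 * INR p + 2) - 2) / (2 * INR p + 2 - 2)) with ((2 * INR p + 1) / INR p)
      in Hlam by (field; lra).
    assert (H0 : 0 < (2 * INR p + 1) / INR p) by (apply Rdiv_lt_0_compat; lra).
    split; [|lra]. unfold gam. rewrite plus_INR, mult_INR. simpl (INR 2). simpl (INR 1).
    apply Rgt_lt, (Rmult_lt_compat_l (INR p)) in Hlam; [|lra].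
    replace (INR p * ((2 * INR p + 1) / INR p)) with (2 * INR p + 1) in Hlam by (field; lra).
    lra. }
  destruct Hgam as [Hgam Hl].
  assert (HS : 0 < INR (S p)) by (apply lt_0_INR; lia).
  set (kap := gam / INR (S p)).
  assert (Hkap : 0 < kap) by (apply Rdiv_lt_0_compat; assumption).
  destruct (piece_source_bounds p Hodd) as [K [B [HK [HB Hsrc]]]].
  (* With d_j = r_j^(2 kap), this threshold is what ln(1/2) - ln d_j >= kap ln(5/r_j) amounts to. *)
  destruct (vanishing_radii phi (ln 2 / kap + ln 5) Hphi_lim) as [r Hr].
  set (c := fun j => axis_point (r j)).
  set (a := fun j => r j * r j).
  set (d := fun j => Rpower (a j) kap).
  assert (Hr01 : forall j, 0 < r j < 1) by (intros j; apply Hr).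
  assert (Ha : forall j, 0 < a j < 1).
  { intros j; specialize (Hr01 j). unfold a. split; [apply Rmult_lt_0_compat; lra|].
    rewrite <- (Rmult_1_l 1). apply Rmult_le_0_lt_compat; lra. }
  assert (Hc : forall j, norm2 n (c j) = a j) by (intros j; apply norm2_axis_point).
  assert (Hd : forall j, 0 < d j <= 1).
  { intros j. split; [apply exp_pos|]. unfold d, Rpower. rewrite <- exp_0.
    assert (ln (a j) < 0) by (rewrite <- ln_1; apply ln_increasing; apply Ha).
    apply Rlt_le, exp_increasing. generalize (Rmult_lt_0_compat kap (- ln (a j))). lra. }
  (* A single unweighted piece has source at most K4 |x|^(-2 p lambda). The weights carry 1/K4, so
     that all sources together stay below |x|^(-2 p lambda), even where pieces overlap. *)
  set (K4 := B * Rpower 5 (INR p * lambda)).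
  assert (HK4 : 0 < K4) by (apply Rmult_lt_0_compat; [exact HB|apply exp_pos]).
  assert (He0 : 0 < / K4) by (apply Rinv_0_lt_compat, HK4).
  set (wt := fun j => / K4 * (/ 2) ^ S j).
  assert (Hwt : forall j, 0 < wt j).
  { intros j. apply Rmult_lt_0_compat; [exact He0|apply pow_lt; lra]. }
  (* The weights sum to at most 1/K4: the second summand pays for the negative parts of all pieces,
     and the 1 leaves |x|^(-2p) as a lower bound for u. *)
  set (C0 := 1 + / K4 * (K * 5 ^ p)).
  set (W := fun k j x => wt j * piece p K (a j) (d j) (c j) k x).
  (* The index k counts Laplacians: [F 0] is u and [F (S p)] is Delta^m u. *)
  set (F := fun k x => C0 * radial_lap p 1 (fun _ => 0) (jet_base p) k x + lsum n (W k) x).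
  assert (Wlap : forall k j, lap n (punct n) (W k j) (W (S k) j)).
  { intros k j. apply lap_scal, lap_piece; [apply Ha|apply Hd]. }
  assert (Wshr : forall k, shrinking n (W k)).
  { induction k as [|k IH]; [|apply (lap_lsum n (W k)); auto].
    intros j x Hx. unfold W. rewrite piece_far; [ring|apply Ha|apply Hc|].
    apply Rlt_le, Rle_lt_trans with (2 := Hx).
    destruct (Hr j) as [H1 [H2 _]]. unfold a.
    assert (HSj : 0 < INR (S j)) by (apply lt_0_INR; lia).
    apply Rle_trans with (5 * r j); [nra|].
    apply (Rmult_le_compat_l 5) in H2; [|lra].
    replace (5 * / (5 * INR (S j))) with (/ INR (S j)) in H2 by (field; lra). exact H2. }
  assert (Bdom : forall x, punct n x -> radial (2 * S p) 1 (fun _ => 0) x < 1)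
    by (intros x Hx; apply radial_lt1; [lra|exact Hx]).
  assert (Flap : forall k, lap n (punct n) (F k) (F (S k))).
  { intros k. apply lap_plus.
    - apply lap_scal, (lap_radial_lap p _ _ _ 1); [apply is_jet_base|exact Bdom].
    - apply (lap_lsum n (W k)); auto. }
  assert (Flow : forall x N, punct n x -> (cutoff (norm2 n x) <= N)%nat ->
    (/ norm2 n x) ^ p + sumR N (fun j => wt j * ((/ a j) ^ p *
       jet_bubble p (d j) 0%nat (radial n (4 / a j) (c j) x))) <= F 0%nat x).
  { intros x N Hx HN. assert (Hx' := Hx). apply punct_norm2 in Hx'.
    unfold F. rewrite (proj2 (radial_lap_base p x Hx)). fold n.
    rewrite (lsum_eq n (W 0%nat) (norm2 n x) x N); [|apply Wshr|lra|exact HN].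
    set (X := (/ norm2 n x) ^ p).
    assert (HX : 0 < X) by (apply pow_lt, Rinv_0_lt_compat, Hx').
    assert (HKp : 0 < K * 5 ^ p) by (apply Rmult_lt_0_compat; [exact HK|apply pow_lt; lra]).
    assert (H1 : sumR N (fun j => wt j * (K * 5 ^ p * X)) <= / K4 * (K * 5 ^ p * X)).
    { apply sumR_weights_le; [intros j _; unfold wt; lra|].
      apply Rlt_le, Rmult_lt_0_compat; [exact He0|apply Rmult_lt_0_compat; assumption]. }
    assert (H2 : sumR N (fun j => wt j * ((/ a j) ^ p *
       jet_bubble p (d j) 0%nat (radial n (4 / a j) (c j) x))) <=
       sumR N (fun j => W 0%nat j x + wt j * (K * 5 ^ p * X))).
    { apply sumR_le. intros j _. unfold W. rewrite <- Rmult_plus_distr_l.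
      apply Rmult_le_compat_l; [apply Rlt_le, Hwt|].
      generalize (piece_lower p K (a j) (d j) (c j) x ltac:(lia) (proj1 (Ha j))
        (Rlt_le _ _ HK) Hx'). fold n X. lra. }
    rewrite sumR_plus in H2. unfold C0. lra. }
  assert (Bpos : forall j x, 0 <= wt j * ((/ a j) ^ p *
       jet_bubble p (d j) 0%nat (radial n (4 / a j) (c j) x))).
  { intros j x. specialize (Ha j).
    apply Rmult_le_pos; [apply Rlt_le, Hwt|]. apply Rmult_le_pos.
    - apply pow_le, Rlt_le, Rinv_0_lt_compat, Ha.
    - apply jet_bubble_nonneg; [apply Hd|]. apply radial_le, Rlt_le, Rdiv_lt_0_compat; lra. }
  assert (Fpos : forall x, punct n x -> 0 < (/ norm2 n x) ^ p <= F 0%nat x).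
  { intros x Hx. split; [apply pow_lt, Rinv_0_lt_compat, punct_norm2, Hx|].
    apply Rle_trans with (2 := Flow x _ Hx (le_n _)).
    assert (H := sumR_nonneg (cutoff (norm2 n x)) _ (fun j _ => Bpos j x)). cbv beta in H. lra. }
  exists (F 0%nat). split; [|split; [|split]].
  - apply smooth_on_of_Ck. intros k. apply Ck_plus.
    + apply (Ck_mult n _ k (fun _ => C0)); [apply Ck_const|].
      apply (Ck_radial_lap p _ _ _ 1); [apply is_jet_base|exact Bdom].
    + apply Ck_lsum; [apply Wshr|]. intros j.
      apply (Ck_mult n _ k (fun _ => wt j)); [apply Ck_const|].
      apply Ck_piece; [apply Ha|apply Hd].
  - intros x Hx. destruct (Fpos x Hx). lra.
  - exists (F (S p)). split; [apply iter_laplacian_chain, Flap|].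
    intros x Hx. destruct (Fpos x Hx) as [F1 F2]. assert (Hx' := Hx). apply punct_norm2 in Hx'.
    (* As u >= |x|^(-2p), T = |x|^(-2 p lambda) is below u^lambda, and the sources need only be
       compared with T. *)
    set (T := Rpower ((/ norm2 n x) ^ p) lambda).
    assert (HT : 0 < T) by apply exp_pos.
    assert (HW : forall j, 0 <= - W (S p) j x <= / K4 * (/ 2) ^ S j * (K4 * T)).
    { intros j. unfold W. rewrite Ropp_mult_distr_r.
      destruct (Rlt_le_dec (norm2 n x) (5 * a j)) as [Hn|Hf].
      - destruct (Hsrc (a j) (d j) (c j) x (proj1 (Ha j)) (Hd j) (Hc j) Hx) as [S1 S2].
        assert (HS3 := source_scale p lambda (a j) (norm2 n x) (Ha j) (conj Hx' Hn)
          (Rlt_le _ _ Hl)). fold gam kap in HS3. fold (d j) T in HS3.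
        apply (Rmult_le_compat_l B) in HS3; [|lra].
        split; [apply Rmult_le_pos; [apply Rlt_le, Hwt|exact S1]|].
        apply Rmult_le_compat_l; [apply Rlt_le, Hwt|].
        unfold K4. lra.
      - rewrite piece_far by (assumption || apply Ha || apply Hc).
        rewrite Ropp_0, Rmult_0_r. split; [lra|].
        apply Rmult_le_pos; [apply Rlt_le, Hwt|]. apply Rmult_le_pos; lra. }
    assert (EF : - F (S p) x = sumR (cutoff (norm2 n x)) (fun j => - W (S p) j x)).
    { unfold F. rewrite (proj1 (radial_lap_base p x Hx)). unfold lsum.
      rewrite (sumR_ext _ (fun j => - W (S p) j x) (fun j => (-1) * W (S p) j x))
        by (intros; ring).
      rewrite sumR_scal. ring. }
    rewrite EF. split; [apply sumR_nonneg; intros; apply HW|].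
    apply Rle_trans with T; [|apply Rle_Rpower_l; lra].
    replace T with (/ K4 * (K4 * T)) by (field; lra).
    apply sumR_weights_le; [intros; apply HW|].
    apply Rmult_le_pos; [lra|apply Rmult_le_pos; lra].
  - intros M delta Hdelta.
    set (G := flat_prim (S (2 * p)) 0%nat (1 / 2)).
    assert (HG : 0 < G) by (apply flat_prim_pos; lra).
    (* The weight of the j-th piece times G kap is A 2^(-j), the coefficient of a_j^(-p) ln(5/r_j)
       in the lower bound for u at x_j. *)
    set (A := / K4 * / 2 * G * kap).
    assert (HA : 0 < A) by (apply Rmult_lt_0_compat; [apply Rmult_lt_0_compat; lra|exact Hkap]).
    destruct (INR_unbounded (Rmax (M / A) (/ delta))) as [j Hj].
    assert (HjM : M / A < INR j) by (apply Rle_lt_trans with (2 := Hj), Rmax_l).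
    assert (Hjd : / delta < INR j) by (apply Rle_lt_trans with (2 := Hj), Rmax_r).
    destruct (Hr j) as [R1 [R2 [R3 R4]]].
    exists (c j).
    (* [2 * S p] reduces to the successor of [p + S (p + 0)]. *)
    assert (En : normn n (c j) = r j) by (apply (normn_axis_point (p + S (p + 0))); lra).
    rewrite En.
    assert (Hid : 0 < / delta) by (apply Rinv_0_lt_compat; lra).
    assert (HSj : INR (S j) = INR j + 1) by apply S_INR.
    split.
    { split; [lra|]. apply Rmin_glb_lt; [|lra].
      apply Rle_lt_trans with (1 := R2). rewrite <- (Rinv_inv delta).
      apply Rinv_lt_contravar; [apply Rmult_lt_0_compat; lra|lra]. }
    assert (Hx : punct n (c j)) by (unfold punct; rewrite En; lra).
    (* The extra [S j] terms guarantee that the j-th one is among those summed. *)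
    set (N := (cutoff (norm2 n (c j)) + S j)%nat).
    assert (HF := Flow (c j) N Hx ltac:(unfold N; lia)).
    assert (HF1 := sumR_ge_term N _ j (fun i _ => Bpos i (c j)) ltac:(unfold N; lia)).
    cbv beta in HF1.
    assert (E1 : radial n (4 / a j) (c j) (c j) = 1)
      by (unfold radial; rewrite dist2_self; ring).
    rewrite E1 in HF1.
    assert (HF2 := jet_bubble_center p (d j) (proj1 (Hd j))). fold G in HF2.
    set (L := ln (5 / r j)).
    assert (EL : L = ln 5 - ln (r j)) by (unfold L; apply ln_div; lra).
    assert (H5 : 0 < ln 5) by (rewrite <- ln_1; apply ln_increasing; lra).
    assert (H2 : 0 < ln 2) by (rewrite <- ln_1; apply ln_increasing; lra).
    assert (HL : 0 < L).
    { assert (0 < ln 2 / kap) by (apply Rdiv_lt_0_compat; lra). lra. }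
    assert (Ed : ln (d j) = kap * (2 * ln (r j))).
    { unfold d, Rpower. rewrite ln_exp. unfold a. rewrite ln_mult by lra. ring. }
    assert (Eh : ln (1 / 2) = - ln 2) by (unfold Rdiv; rewrite Rmult_1_l; apply ln_Rinv; lra).
    assert (HL2 : kap * L <= ln (1 / 2) - ln (d j)).
    { apply (Rmult_le_compat_l kap) in R4; [|lra].
      replace (kap * (ln 2 / kap + ln 5)) with (ln 2 + kap * ln 5) in R4 by (field; lra).
      rewrite Ed, Eh, EL. lra. }
    assert (Hap : 0 < (/ a j) ^ p) by (apply pow_lt, Rinv_0_lt_compat, Ha).
    assert (HF3 : wt j * ((/ a j) ^ p * (G * (kap * L))) <= F 0%nat (c j)).
    { apply Rle_trans with (wt j * ((/ a j) ^ p * jet_bubble p (d j) 0%nat 1)).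
      - apply Rmult_le_compat_l; [apply Rlt_le, Hwt|].
        apply Rmult_le_compat_l; [lra|].
        apply Rle_trans with (2 := HF2). apply Rmult_le_compat_l; lra.
      - destruct (Fpos (c j) Hx). lra. }
    destruct (Hphi_range (r j) R1) as [P1 P2].
    rewrite Rabs_pos_eq in R3 by lra.
    replace (n - 2)%nat with (2 * p)%nat by (unfold n; lia).
    rewrite pow_mult. replace (r j ^ 2) with (a j) by (unfold a; ring).
    assert (Haj : 0 < a j ^ p) by (apply pow_lt, Ha).
    apply Rlt_gt.
    assert (HD : 0 < phi (r j) / a j ^ p * L)
      by (apply Rmult_lt_0_compat; [apply Rdiv_lt_0_compat; lra|exact HL]).
    apply Rmult_lt_reg_r with (phi (r j) / a j ^ p * L); [exact HD|].
    unfold Rdiv at 2. rewrite Rmult_assoc, Rinv_l, Rmult_1_r by lra.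
    apply Rlt_le_trans with (2 := HF3).
    rewrite pow_inv.
    replace (wt j * (/ a j ^ p * (G * (kap * L)))) with (A * (/ 2) ^ j * / a j ^ p * L)
      by (unfold wt, A; simpl; ring).
    replace (M * (phi (r j) / a j ^ p * L)) with (M * phi (r j) * / a j ^ p * L)
      by (unfold Rdiv; ring).
    assert (Hia : 0 < / a j ^ p) by (apply Rinv_0_lt_compat, Haj).
    apply Rmult_lt_compat_r; [exact HL|]. apply Rmult_lt_compat_r; [exact Hia|].
    assert (H2j : INR j < 2 ^ j).
    { clear. induction j as [|j IH]; [simpl; lra|]. rewrite S_INR. simpl.
      generalize (pow_R1_Rle 2 j ltac:(lra)). lra. }
    assert (HM : M < A * 2 ^ j).
    { apply (Rmult_lt_compat_l A) in HjM; [|exact HA].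
      replace (A * (M / A)) with M in HjM by (field; lra).
      generalize (Rmult_lt_compat_l A _ _ HA H2j). lra. }
    (* M < A 2^j comes from j > M/A and 2^j > j; then phi(r_j) < 4^(-j) turns A 2^j phi(r_j) into at
       most A 2^(-j). *)
    apply Rlt_le_trans with (A * 2 ^ j * phi (r j)); [apply Rmult_lt_compat_r; lra|].
    apply Rle_trans with (A * 2 ^ j * (/ 4) ^ j).
    + apply Rmult_le_compat_l; [|lra]. apply Rmult_le_pos; [lra|apply pow_le; lra].
    + right. rewrite Rmult_assoc, <- Rpow_mult_distr. do 2 f_equal. field.
Qed.
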